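(* Let $X$ and $Y$ be connected, locally path-connected, semilocally simply-connected topological spaces, let $f:X\to Y$ be continuous, let $x_0\in X$ and $y_0:=f(x_0)$, let $J:=\pi_1(X,x_0)$, $G:=\pi_1(Y,y_0)$, let $f_{\sharp}:J\to G$ be the induced homomorphism, and let $H:=\operatorname{Im} f_{\sharp}$. Suppose $f_{\sharp}$ is not surjective. (1) If $[G:H]<\infty$, then there exist two nonisomorphic, finite sheeted covers of $Y$ with isomorphic pullbacks under $f^{\ast}$; equivalently, there exist two nonisomorphic finite $G$-sets with isomorphic pullbacks under $f_{\sharp}^{\ast}$. (2) In general (with no assumption on $[G:H]$), there exist two nonisomorphic covers of $Y$, each having finitely many components, with isomorphic pullbacks under $f^{\ast}$; equivalently, there exist two nonisomorphic $G$-sets with finite orbit spaces and with isomorphic pullbacks under $f_{\sharp}^{\ast}$.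
   Context: Spaces are not required to be Hausdorff. $\mathrm{Cov}(Y)$ is the category of unbased coverings $p:E\to Y$ ($E$ may be disconnected or empty); a morphism from $p_1:E_1\to Y$ to $p_2:E_2\to Y$ is a continuous map $t:E_1\to E_2$ with $p_1=p_2\circ t$. The topological pullback functor $f^{\ast}:\mathrm{Cov}(Y)\to\mathrm{Cov}(X)$ sends $p:E\to Y$ to $f^{\ast}(p):f^{\ast}(E)\to X$, where $f^{\ast}(E):=\{(x,e)\in X\times E\mid f(x)=p(e)\}$ and $f^{\ast}(p)$ is the restriction of the projection to $X$; it sends a morphism $t$ to the restriction of $\mathrm{id}_X\times t$. $G$-sets are right $G$-sets, with $G$-equivariant functions as morphisms. The algebraic pullback functor $f_{\sharp}^{\ast}:G\text{-}\mathbf{set}\to J\text{-}\mathbf{set}$ sends a $G$-set $S$ to the same set $S$ with action $s\cdot j:=s\cdot f_{\sharp}(j)$, and is the identity on underlying functions of morphisms. The orbit space of a $G$-set $S$ is its set $S/G$ of $G$-orbits. *)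

(* Defs.v *)
From HB Require Import structures.
From mathcomp Require Import all_boot all_order all_algebra.
From mathcomp Require Import all_classical all_reals topology normedtype.
From mathcomp Require Import continuous_path.
From mathcomp Require Import lra.
Set Implicit Arguments.
Unset Strict Implicit.
Unset Printing Implicit Defensive.
Import Order.TTheory GRing.Theory Num.Theory numFieldNormedType.Exports.
Local Open Scope classical_set_scope.
Local Open Scope ring_scope.
Local Open Scope quotient_scope.

Definition unit_interval (R : realType) : Type := set_type `[0%R : R, 1%R].

Section unit_interval.
Context {R : realType}.
Local Notation I := (unit_interval R).

HB.instance Definition _ := Topological.copy I (set_type `[0%R : R, 1%R]).

Definition iR (s : I) : R := \val s.

Lemma iR_ge0 (s : I) : 0 <= iR s.
Proof.
by have /set_mem /= := valP s; rewrite in_itv /= => /andP[].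
Qed.

Lemma iR_le1 (s : I) : iR s <= 1.
Proof.
by have /set_mem /= := valP s; rewrite in_itv /= => /andP[].
Qed.

Lemma clamp_subproof (t : R) :
  Num.max 0 (Num.min 1 t) \in [set` `[0%R : R, 1%R]].
Proof.
apply/mem_set => /=; rewrite in_itv /= le_max lexx /= ge_max ler01 /=.
by rewrite ge_min lexx.
Qed.

(* The retraction of the real line onto the unit interval. *)
Definition clamp (t : R) : I :=
  exist (fun t : R => t \in [set` `[0%R : R, 1%R]]) _ (clamp_subproof t).

Lemma iR_clamp t : iR (clamp t) = Num.max 0 (Num.min 1 t).
Proof. by []. Qed.

Lemma iR_inj : injective iR.
Proof. exact: val_inj. Qed.

Lemma clampK t : 0 <= t <= 1 -> iR (clamp t) = t.
Proof.
by move=> /andP[t0 t1]; rewrite iR_clamp (min_idPr t1) (max_idPr t0).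
Qed.

Lemma iRK : cancel iR clamp.
Proof. by move=> s; apply: iR_inj; rewrite clampK // iR_ge0 iR_le1. Qed.

Lemma clamp01_subproof : clamp 0 != clamp 1.
Proof.
apply/eqP => /(congr1 iR); rewrite !clampK ?lexx ?ler01 // => /eqP.
by rewrite eq_sym oner_eq0.
Qed.

HB.instance Definition _ := isBiPointed.Build I clamp01_subproof.

Lemma clamp0 : clamp 0 = zero. Proof. by []. Qed.
Lemma clamp1 : clamp 1 = one. Proof. by []. Qed.
Lemma iR0 : iR zero = 0. Proof. by rewrite -clamp0 clampK ?lexx ?ler01. Qed.
Lemma iR1 : iR one = 1. Proof. by rewrite -clamp1 clampK ?lexx ?ler01. Qed.

Lemma clamp_le0 t : t <= 0 -> clamp t = zero.
Proof.
move=> t0; apply: iR_inj; rewrite iR0 iR_clamp; apply/max_idPl.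
by rewrite ge_min t0 orbT.
Qed.

Lemma clamp_ge1 t : 1 <= t -> clamp t = one.
Proof.
move=> t0; apply: iR_inj; rewrite iR1 iR_clamp (min_idPl t0).
exact/max_idPr.
Qed.

Lemma continuous_iR : continuous iR.
Proof. exact: initial_continuous. Qed.

Lemma continuous_clamp : continuous clamp.
Proof.
apply: continuous_comp_initial => t.
apply: (@continuous_max R R (cst 0) (fun t => Num.min 1 t)).
  exact: cst_continuous.
apply: (@continuous_min R R (cst 1) id); first exact: cst_continuous.
by move=> ?.
Qed.


Lemma pair_continuous (Z A B : topologicalType) (f : Z -> A) (g : Z -> B) :
  continuous f -> continuous g -> continuous (fun z => (f z, g z)).
Proof. by move=> cf cg z; exact: (cvg_pair (cf z) (cg z)). Qed.

Lemma paste_continuous (Z T : topologicalType) (u : Z -> R) (a b : Z -> T) :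
  continuous u -> continuous a -> continuous b ->
  (forall z, u z = 2^-1 -> a z = b z) ->
  continuous (fun z => if u z <= 2^-1 then a z else b z).
Proof.
move=> cu ca cb ab.
set h := (fun z => _).
pose A : set Z := u @^-1` [set t | t <= 2^-1].
pose B : set Z := u @^-1` [set t | 2^-1 <= t].
have AB : A `|` B = setT.
  by apply/seteqP; split=> // z _; apply/orP; exact: le_total.
apply/continuous_subspace_setT; rewrite -AB.
apply: withinU_continuous.
- by apply: preimage_closed => //; exact: closed_le.
- by apply: preimage_closed => //; exact: closed_ge.
- apply: (@subspace_eq_continuous _ _ _ a); last exact: continuous_subspaceT.
  move=> z /set_mem /= zA; change (a z = h z).
  by move: zA; rewrite /h => ->.
- apply: (@subspace_eq_continuous _ _ _ b); last exact: continuous_subspaceT.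
  move=> z /set_mem /= zB; change (b z = h z).
  rewrite /h; case: ifPn => // zA.
  by apply/esym/ab/eqP; rewrite eq_le zB zA.
Qed.

End unit_interval.

Section path_homotopy.
Context {R : realType} {X : topologicalType}.
Local Notation I := (unit_interval R).

Section endpoints.
Context {x y : X}.
Implicit Types p q r : {path I from x to y in X}.

Definition path_homotopic p q : Prop :=
  exists H : I * I -> X, [/\ continuous H,
    forall s, H (s, zero) = p s, forall s, H (s, one) = q s,
    forall t, H (zero, t) = x & forall t, H (one, t) = y].

Lemma path_homotopicR p q (K : R * R -> X) : continuous K ->
  (forall s, K (iR s, 0) = p s) -> (forall s, K (iR s, 1) = q s) ->
  (forall t, 0 <= t <= 1 -> K (0, t) = x) ->
  (forall t, 0 <= t <= 1 -> K (1, t) = y) -> path_homotopic p q.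
Proof.
move=> cK Kp Kq Kx Ky; exists (fun st => K (iR st.1, iR st.2)); split => /=.
- move=> st; apply: (@continuous_comp _ _ _ (fun st : I * I => (iR st.1, iR st.2)) K);
    last exact: cK.
  apply: pair_continuous => {}st.
    by apply: (@continuous_comp _ _ _ fst iR); [exact: cvg_fst|exact: continuous_iR].
  by apply: (@continuous_comp _ _ _ snd iR); [exact: cvg_snd|exact: continuous_iR].
- by move=> s; rewrite iR0.
- by move=> s; rewrite iR1.
- by move=> t; rewrite iR0 Kx // iR_ge0 iR_le1.
- by move=> t; rewrite iR1 Ky // iR_ge0 iR_le1.
Qed.

Lemma path_homotopic_eq p q : p =1 q -> path_homotopic p q.
Proof.
move=> pq; exists (fun st => p st.1); split => //=.
- move=> st; apply: (@continuous_comp _ _ _ fst p); first exact: cvg_fst.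
  exact: cts_fun.
- by move=> _; rewrite path_zero.
- by move=> _; rewrite path_one.
Qed.

End endpoints.

Lemma path_homotopic_reparam {x y x' y' : X} (p : {path I from x to y in X})
    (q r : {path I from x' to y' in X}) (phi psi : R -> R) :
  continuous phi -> continuous psi -> phi 0 = psi 0 -> phi 1 = psi 1 ->
  (forall s, q s = p (clamp (phi (iR s)))) ->
  (forall s, r s = p (clamp (psi (iR s)))) -> path_homotopic q r.
Proof.
move=> cphi cpsi e0 e1 qE rE.
apply: (@path_homotopicR _ _ _ _
  (fun st => p (clamp (phi st.1 + st.2 * (psi st.1 - phi st.1))))) => /=.
- move=> st.
  apply: (@continuous_comp _ _ _
    (fun st : R * R => phi st.1 + st.2 * (psi st.1 - phi st.1)) (p \o clamp)).
    have c1 g : continuous g -> {for st, continuous (fun st : R * R => g st.1 : R)}.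
      by move=> cg; apply: (@continuous_comp _ _ _ fst g); [exact: cvg_fst|exact: cg].
    apply: continuousD; first exact: c1.
    apply: continuousM; first exact: cvg_snd.
    by apply: continuousB; exact: c1.
  apply: continuous_comp; first exact: continuous_clamp.
  exact: cts_fun.
- by move=> s; rewrite mul0r addr0 qE.
- by move=> s; rewrite mul1r addrC subrK rE.
- by move=> t _; rewrite e0 subrr mulr0 addr0 -e0 -iR0 -qE path_zero.
- by move=> t _; rewrite e1 subrr mulr0 addr0 -e1 -iR1 -qE path_one.
Qed.

Section composition.
Context {x y z : X}.

Definition concat_fun (p : I -> X) (q : I -> X) (s : I) : X :=
  if iR s <= 2^-1 then p (clamp (2 * iR s)) else q (clamp (2 * iR s - 1)).

Variables (p : {path I from x to y in X}) (q : {path I from y to z in X}).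

Lemma concat_continuous : continuous (concat_fun p q).
Proof.
apply: paste_continuous; first exact: continuous_iR.
- move=> s.
  apply: (@continuous_comp _ _ _ (fun s : I => 2 * iR s) (p \o clamp)).
    by apply: continuousM; [exact: cst_continuous|exact: continuous_iR].
  by apply: continuous_comp; [exact: continuous_clamp|exact: cts_fun].
- move=> s.
  apply: (@continuous_comp _ _ _ (fun s : I => 2 * iR s - 1) (q \o clamp)).
    apply: continuousB; last exact: cst_continuous.
    by apply: continuousM; [exact: cst_continuous|exact: continuous_iR].
  by apply: continuous_comp; [exact: continuous_clamp|exact: cts_fun].
- move=> s ->; rewrite mulfV ?pnatr_eq0 // subrr.
  by rewrite clamp0 clamp1 path_zero path_one.
Qed.

Lemma concat_zero : concat_fun p q zero = x.
Proof. by rewrite /concat_fun iR0 invr_ge0 ler0n mulr0 clamp0 path_zero. Qed.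

Lemma concat_one : concat_fun p q one = z.
Proof.
rewrite /concat_fun iR1 ifF; last by apply/negbTE; rewrite -ltNge; lra.
by rewrite mulr1 [2 - 1](_ : _ = 1) ?clamp1 ?path_one //; lra.
Qed.

(* First p, then q, each at double speed. *)
Definition concat : {path I from x to z in X} :=
  mk_path concat_continuous concat_zero concat_one.

Lemma inverse_continuous : continuous (fun s : I => p (clamp (1 - iR s))).
Proof.
move=> s; apply: (@continuous_comp _ _ _ (fun s : I => 1 - iR s) (p \o clamp)).
  by apply: continuousB; [exact: cst_continuous|exact: continuous_iR].
by apply: continuous_comp; [exact: continuous_clamp|exact: cts_fun].
Qed.

Lemma inverse_zero : p (clamp (1 - iR zero)) = y.
Proof. by rewrite iR0 subr0 clamp1 path_one. Qed.

Lemma inverse_one : p (clamp (1 - iR one)) = x.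
Proof. by rewrite iR1 subrr clamp0 path_zero. Qed.

Definition inverse : {path I from y to x in X} :=
  mk_path inverse_continuous inverse_zero inverse_one.

End composition.

Definition const_path (x : X) : {path I from x to x in X} := cst x.

Section homotopy_equivalence.
Context {x y : X}.
Implicit Types p q r : {path I from x to y in X}.

Lemma path_homotopic_sym p q : path_homotopic p q -> path_homotopic q p.
Proof.
move=> [H [cH Hp Hq Hx Hy]].
exists (fun st => H (st.1, clamp (1 - iR st.2))); split => /=.
- move=> st; apply: (@continuous_comp _ _ _
    (fun st : I * I => (st.1, clamp (1 - iR st.2))) H); last exact: cH.
  apply: pair_continuous => {}st; first exact: cvg_fst.
  apply: (@continuous_comp _ _ _ (fun st : I * I => 1 - iR st.2) clamp);
    last exact: continuous_clamp.
  apply: continuousB; first exact: cst_continuous.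
  by apply: (@continuous_comp _ _ _ snd iR); [exact: cvg_snd|exact: continuous_iR].
- by move=> s; rewrite iR0 subr0 clamp1.
- by move=> s; rewrite iR1 subrr clamp0.
- by move=> t.
- by move=> t.
Qed.

Lemma path_homotopic_trans p q r :
  path_homotopic p q -> path_homotopic q r -> path_homotopic p r.
Proof.
move=> [H [cH Hp Hq Hx Hy]] [K [cK Kq Kr Kx Ky]].
exists (fun st : I * I => if iR st.2 <= 2^-1 then H (st.1, clamp (2 * iR st.2))
  else K (st.1, clamp (2 * iR st.2 - 1))); split => /=.
- apply: (@paste_continuous _ _ _ (fun st : I * I => iR st.2)
    (fun st => H (st.1, clamp (2 * iR st.2)))
    (fun st => K (st.1, clamp (2 * iR st.2 - 1)))).
  + move=> st.
    by apply: (@continuous_comp _ _ _ snd iR); [exact: cvg_snd|exact: continuous_iR].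
  + move=> st; apply: (@continuous_comp _ _ _
      (fun st : I * I => (st.1, clamp (2 * iR st.2))) H); last exact: cH.
    apply: pair_continuous => {}st; first exact: cvg_fst.
    apply: (@continuous_comp _ _ _ (fun st : I * I => 2 * iR st.2) clamp);
      last exact: continuous_clamp.
    apply: continuousM; first exact: cst_continuous.
    by apply: (@continuous_comp _ _ _ snd iR); [exact: cvg_snd|exact: continuous_iR].
  + move=> st; apply: (@continuous_comp _ _ _
      (fun st : I * I => (st.1, clamp (2 * iR st.2 - 1))) K); last exact: cK.
    apply: pair_continuous => {}st; first exact: cvg_fst.
    apply: (@continuous_comp _ _ _ (fun st : I * I => 2 * iR st.2 - 1) clamp);
      last exact: continuous_clamp.
    apply: continuousB; last exact: cst_continuous.
    apply: continuousM; first exact: cst_continuous.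
    by apply: (@continuous_comp _ _ _ snd iR); [exact: cvg_snd|exact: continuous_iR].
  + by move=> [s t] /= ->; rewrite mulfV ?pnatr_eq0 // subrr clamp0 clamp1 Hq Kq.
- by move=> s; rewrite iR0 invr_ge0 ler0n mulr0 clamp0 Hp.
- move=> s; rewrite iR1 ifF; last by apply/negbTE; rewrite -ltNge; lra.
  by rewrite mulr1 [2 - 1](_ : _ = 1) ?clamp1 ?Kr //; lra.
- by move=> t; case: ifP.
- by move=> t; case: ifP.
Qed.

Lemma path_homotopic_refl p : path_homotopic p p.
Proof. exact: path_homotopic_eq. Qed.

Definition path_homotopicb p q : bool := `[< path_homotopic p q >].

Lemma path_homotopicb_refl : reflexive path_homotopicb.
Proof. by move=> p; apply/asboolP/path_homotopic_refl. Qed.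

Lemma path_homotopicb_sym : symmetric path_homotopicb.
Proof. by move=> p q; apply/asboolP/asboolP; exact: path_homotopic_sym. Qed.

Lemma path_homotopicb_trans : transitive path_homotopicb.
Proof.
by move=> q p r /asboolP pq /asboolP qr; apply/asboolP/(path_homotopic_trans pq).
Qed.

Canonical path_homotopicb_equiv := EquivRel path_homotopicb
  path_homotopicb_refl path_homotopicb_sym path_homotopicb_trans.

End homotopy_equivalence.

Section congruence.
Context {x y z : X}.

Lemma concat_homotopic (p p' : {path I from x to y in X})
    (q q' : {path I from y to z in X}) :
  path_homotopic p p' -> path_homotopic q q' ->
  path_homotopic (concat p q) (concat p' q').
Proof.
move=> [H [cH Hp Hq Hx Hy]] [K [cK Kq Kr Kx Ky]].
exists (fun st : I * I => if iR st.1 <= 2^-1 then H (clamp (2 * iR st.1), st.2)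
  else K (clamp (2 * iR st.1 - 1), st.2)); split => /=.
- apply: (@paste_continuous _ _ _ (fun st : I * I => iR st.1)
    (fun st => H (clamp (2 * iR st.1), st.2))
    (fun st => K (clamp (2 * iR st.1 - 1), st.2))).
  + move=> st.
    by apply: (@continuous_comp _ _ _ fst iR); [exact: cvg_fst|exact: continuous_iR].
  + move=> st; apply: (@continuous_comp _ _ _
      (fun st : I * I => (clamp (2 * iR st.1), st.2)) H); last exact: cH.
    apply: pair_continuous => {}st; last exact: cvg_snd.
    apply: (@continuous_comp _ _ _ (fun st : I * I => 2 * iR st.1) clamp);
      last exact: continuous_clamp.
    apply: continuousM; first exact: cst_continuous.
    by apply: (@continuous_comp _ _ _ fst iR); [exact: cvg_fst|exact: continuous_iR].
  + move=> st; apply: (@continuous_comp _ _ _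
      (fun st : I * I => (clamp (2 * iR st.1 - 1), st.2)) K); last exact: cK.
    apply: pair_continuous => {}st; last exact: cvg_snd.
    apply: (@continuous_comp _ _ _ (fun st : I * I => 2 * iR st.1 - 1) clamp);
      last exact: continuous_clamp.
    apply: continuousB; last exact: cst_continuous.
    apply: continuousM; first exact: cst_continuous.
    by apply: (@continuous_comp _ _ _ fst iR); [exact: cvg_fst|exact: continuous_iR].
  + by move=> [s t] /= ->; rewrite mulfV ?pnatr_eq0 // subrr clamp0 clamp1 Hy Kx.
- by move=> s; rewrite /mk_path /concat_fun; case: ifP; rewrite ?Hp ?Kq.
- by move=> s; rewrite /mk_path /concat_fun; case: ifP; rewrite ?Hq ?Kr.
- by move=> t; rewrite iR0 invr_ge0 ler0n mulr0 clamp0 Hx.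
- move=> t; rewrite iR1 ifF; last by apply/negbTE; rewrite -ltNge; lra.
  by rewrite mulr1 [2 - 1](_ : _ = 1) ?clamp1 ?Ky //; lra.
Qed.

Lemma inverse_homotopic (p p' : {path I from x to y in X}) :
  path_homotopic p p' -> path_homotopic (inverse p) (inverse p').
Proof.
move=> [H [cH Hp Hq Hx Hy]].
exists (fun st => H (clamp (1 - iR st.1), st.2)); split => /=.
- move=> st; apply: (@continuous_comp _ _ _
    (fun st : I * I => (clamp (1 - iR st.1), st.2)) H); last exact: cH.
  apply: pair_continuous => {}st; last exact: cvg_snd.
  apply: (@continuous_comp _ _ _ (fun st : I * I => 1 - iR st.1) clamp);
    last exact: continuous_clamp.
  apply: continuousB; first exact: cst_continuous.
  by apply: (@continuous_comp _ _ _ fst iR); [exact: cvg_fst|exact: continuous_iR].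
- by move=> s; rewrite Hp.
- by move=> s; rewrite Hq.
- by move=> t; rewrite iR0 subr0 clamp1.
- by move=> t; rewrite iR1 subrr clamp0.
Qed.

End congruence.

Section laws.
Context {x y z w : X}.
Implicit Types (p : {path I from x to y in X}) (q : {path I from y to z in X})
  (r : {path I from z to w in X}).

Lemma half_false : (1 <= 2^-1 :> R) = false.
Proof. by apply/negbTE; rewrite -ltNge; lra. Qed.

Lemma affine_continuous (a b : R) : continuous (fun t : R => a * t + b).
Proof.
move=> t; apply: continuousD; last exact: cst_continuous.
by apply: continuousM; [exact: cst_continuous|move=> ?].
Qed.

Lemma const_concat p : path_homotopic (concat (const_path x) p) p.
Proof.
apply: (@path_homotopic_reparam _ _ _ _ p _ _
  (fun t => Num.max 0 (2 * t + - 1)) id).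
- move=> t; apply: (@continuous_max R R (cst 0) (fun t => 2 * t + - 1)).
    exact: cst_continuous.
  exact: affine_continuous.
- by move=> ?.
- by rewrite mulr0 add0r; apply/max_idPl; lra.
- by rewrite mulr1 (_ : 2 - 1 = 1 :> R); [apply/max_idPr; lra|lra].
- move=> s; rewrite /= /mk_path /concat_fun; case: (leP (iR s) 2^-1) => hs.
    by rewrite (max_idPl _) ?clamp0 ?path_zero //; lra.
  by rewrite (max_idPr _) //; lra.
- by move=> s; rewrite iRK.
Qed.

Lemma concat_const p : path_homotopic (concat p (const_path y)) p.
Proof.
apply: (@path_homotopic_reparam _ _ _ _ p _ _
  (fun t => Num.min 1 (2 * t + 0)) id).
- move=> t; apply: (@continuous_min R R (cst 1) (fun t => 2 * t + 0)).
    exact: cst_continuous.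
  exact: affine_continuous.
- by move=> ?.
- by rewrite mulr0 add0r; apply/min_idPr; lra.
- by rewrite mulr1 addr0; apply/min_idPl; lra.
- move=> s; rewrite /= /mk_path /concat_fun addr0; case: (leP (iR s) 2^-1) => hs.
    by rewrite (min_idPr _) //; lra.
  by rewrite (min_idPl _) ?clamp1 ?path_one //; lra.
- by move=> s; rewrite iRK.
Qed.

Lemma concat_inverse p : path_homotopic (concat p (inverse p)) (const_path x).
Proof.
apply: (@path_homotopic_reparam _ _ _ _ p _ _
  (fun t => Num.min (2 * t + 0) (- 2 * t + 2)) (cst 0)).
- move=> t; apply: (@continuous_min R R (fun t => 2 * t + 0) (fun t => - 2 * t + 2));
    exact: affine_continuous.
- exact: cst_continuous.
- by rewrite !mulr0 !add0r; apply/min_idPl; lra.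
- by rewrite !mulr1 addr0 addNr; apply/min_idPr; lra.
- move=> s; rewrite /= /mk_path /concat_fun addr0; case: (leP (iR s) 2^-1) => hs.
    by rewrite (min_idPl _) //; lra.
  rewrite /= clampK; last by have := iR_le1 s; move=> ?; apply/andP; split; lra.
  rewrite (min_idPr _); last lra.
  by congr (p (clamp _)); lra.
- by move=> s /=; rewrite clamp0 path_zero.
Qed.

Lemma inverse_concat p : path_homotopic (concat (inverse p) p) (const_path y).
Proof.
apply: (@path_homotopic_reparam _ _ _ _ p _ _
  (fun t => Num.max (- 2 * t + 1) (2 * t + - 1)) (cst 1)).
- move=> t; apply: (@continuous_max R R (fun t => - 2 * t + 1) (fun t => 2 * t + - 1));
    exact: affine_continuous.
- exact: cst_continuous.
- by rewrite !mulr0 !add0r; apply/max_idPl; lra.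
- by rewrite !mulr1 (_ : 2 - 1 = 1 :> R); [apply/max_idPr; lra|lra].
- move=> s; rewrite /= /mk_path /concat_fun; case: (leP (iR s) 2^-1) => hs.
    rewrite /= clampK; last by have := iR_ge0 s; move=> ?; apply/andP; split; lra.
    rewrite (max_idPl _); last lra.
    by congr (p (clamp _)); lra.
  by rewrite (max_idPr _) //; lra.
- by move=> s /=; rewrite clamp1 path_one.
Qed.

Lemma concatA p q r :
  path_homotopic (concat p (concat q r)) (concat (concat p q) r).
Proof.
apply: path_homotopic_sym.
apply: (@path_homotopic_reparam _ _ _ _ (concat p (concat q r)) _ _
  (fun t => Num.min (2 * t + 0) (Num.min (1 * t + 4^-1) (2^-1 * t + 2^-1))) id).
- move=> t; apply: (@continuous_min R R (fun t => 2 * t + 0)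
    (fun t => Num.min (1 * t + 4^-1) (2^-1 * t + 2^-1))).
    exact: affine_continuous.
  by apply: (@continuous_min R R (fun t => 1 * t + 4^-1)
    (fun t => 2^-1 * t + 2^-1)); exact: affine_continuous.
- by move=> ?.
- by rewrite !mulr0 !add0r; apply/min_idPl; rewrite le_min; apply/andP; split; lra.
- rewrite !mulr1 [X in Num.min _ X](min_idPr _); last lra.
  by rewrite (min_idPr _) /=; lra.
- move=> s; rewrite addr0 mul1r.
  have s0 := iR_ge0 s; have s1 := iR_le1 s.
  rewrite /= /mk_path {1}/concat_fun.
  case: (leP (iR s) 2^-1) => hs; last first.
    rewrite [X in Num.min _ X](min_idPr _); last lra.
    rewrite (min_idPr _); last lra.
    rewrite /concat_fun clampK; last by apply/andP; split; lra.
    rewrite ifF; last by apply/negbTE; rewrite -ltNge; lra.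
    rewrite clampK; last by apply/andP; split; lra.
    rewrite ifF; last by apply/negbTE; rewrite -ltNge; lra.
    by congr (r (clamp _)); lra.
  rewrite [X in Num.min _ X](min_idPl _); last lra.
  rewrite /= /mk_path /concat_fun clampK; last by apply/andP; split; lra.
  case: (leP (2 * iR s) 2^-1) => hs'.
    rewrite (min_idPl _); last lra.
    by rewrite clampK ?hs' //; apply/andP; split; lra.
  rewrite (min_idPr _); last lra.
  rewrite clampK; last by apply/andP; split; lra.
  rewrite ifF; last by apply/negbTE; rewrite -ltNge; lra.
  rewrite clampK; last by apply/andP; split; lra.
  rewrite ifT; last by lra.
  by congr (q (clamp _)); lra.
- by move=> s; rewrite iRK.
Qed.

End laws.

End path_homotopy.

Section fundamental_group.
Variables (R : realType) (X : topologicalType).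
Local Notation I := (unit_interval R).

Definition pi1 (x : X) : Type :=
  {eq_quot (@path_homotopicb_equiv R X x x)}.

End fundamental_group.
Arguments pi1 R {X} x.

Section pi1.
Context {R : realType} {X : topologicalType}.
Local Notation I := (unit_interval R).
Context {x : X}.
Local Notation loop := {path I from x to x in X}.

HB.instance Definition _ := Choice.on (pi1 R x).
HB.instance Definition _ := EqQuotient.on (pi1 R x).

Definition pi1_class (p : loop) : pi1 R x := \pi_(pi1 R x) p.

Lemma pi1_classP p q : pi1_class p = pi1_class q <-> path_homotopic p q.
Proof.
split=> [/eqmodP /asboolP //|pq]; apply/eqmodP; exact/asboolP.
Qed.

Lemma pi1_ind (P : pi1 R x -> Prop) : (forall p, P (pi1_class p)) -> forall a, P a.
Proof. by move=> Pp a; rewrite -[a]reprK; exact: Pp. Qed.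

(* In a product, the left factor is traversed first. *)
Definition pi1_mul (a b : pi1 R x) : pi1 R x := pi1_class (concat (repr a) (repr b)).
Definition pi1_one : pi1 R x := pi1_class (const_path x).
Definition pi1_inv (a : pi1 R x) : pi1 R x := pi1_class (inverse (repr a)).

Lemma repr_class p : path_homotopic (repr (pi1_class p)) p.
Proof. by apply/pi1_classP; exact: reprK. Qed.

Lemma pi1_mulE p q : pi1_mul (pi1_class p) (pi1_class q) = pi1_class (concat p q).
Proof. by apply/pi1_classP/concat_homotopic; exact: repr_class. Qed.

Lemma pi1_invE p : pi1_inv (pi1_class p) = pi1_class (inverse p).
Proof. by apply/pi1_classP/inverse_homotopic; exact: repr_class. Qed.

Lemma pi1_mulA : associative pi1_mul.
Proof.
elim/pi1_ind => p; elim/pi1_ind => q; elim/pi1_ind => r.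
by rewrite !pi1_mulE; apply/pi1_classP/concatA.
Qed.

Lemma pi1_mul1g : left_id pi1_one pi1_mul.
Proof.
by elim/pi1_ind => p; rewrite pi1_mulE; apply/pi1_classP/const_concat.
Qed.

Lemma pi1_mulg1 : right_id pi1_one pi1_mul.
Proof.
by elim/pi1_ind => p; rewrite pi1_mulE; apply/pi1_classP/concat_const.
Qed.

Lemma pi1_mulVg : left_inverse pi1_one pi1_inv pi1_mul.
Proof.
by elim/pi1_ind => p; rewrite pi1_invE pi1_mulE; apply/pi1_classP/inverse_concat.
Qed.

Lemma pi1_mulgV : right_inverse pi1_one pi1_inv pi1_mul.
Proof.
by elim/pi1_ind => p; rewrite pi1_invE pi1_mulE; apply/pi1_classP/concat_inverse.
Qed.

HB.instance Definition _ := isGroup.Build (pi1 R x)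
  pi1_mulA pi1_mul1g pi1_mulg1 pi1_mulVg pi1_mulgV.

End pi1.
Arguments pi1_one R {X} x.

Section induced_morphism.
Variables (R : realType) (X Y : topologicalType) (f : continuousType X Y).
Local Notation I := (unit_interval R).

Lemma comp_homotopic (x y : X) (p q : {path I from x to y in X}) :
  path_homotopic p q ->
  path_homotopic (f \o p : {path I from f x to f y in Y}) (f \o q).
Proof.
move=> [H [cH Hp Hq Hx Hy]]; exists (f \o H); split => /=.
- by move=> st; apply: continuous_comp; [exact: cH|exact: cts_fun].
- by move=> s; rewrite Hp.
- by move=> s; rewrite Hq.
- by move=> t; rewrite Hx.
- by move=> t; rewrite Hy.
Qed.

Definition pi1_map (x : X) (a : pi1 R x) : pi1 R (f x) :=
  pi1_class (f \o repr a : {path I from f x to f x in Y}).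

Lemma pi1_mapE (x : X) (p : {path I from x to x in X}) :
  pi1_map (pi1_class p) = pi1_class (f \o p : {path I from f x to f x in Y}).
Proof. by apply/pi1_classP/comp_homotopic/repr_class. Qed.

Lemma pi1_map1 (x : X) : pi1_map (pi1_one R x) = pi1_one R (f x).
Proof. by rewrite pi1_mapE; apply/pi1_classP/path_homotopic_eq. Qed.

Lemma pi1_mapM (x : X) (a b : pi1 R x) :
  pi1_map (pi1_mul a b) = pi1_mul (pi1_map a) (pi1_map b).
Proof.
move: a; apply: pi1_ind => p; move: b; apply: pi1_ind => q.
rewrite pi1_mulE !pi1_mapE pi1_mulE; apply/pi1_classP/path_homotopic_eq => s.
by rewrite /= /mk_path /concat_fun /=; case: ifP.
Qed.

Lemma pi1_map_morphism (x : X) : monoid.monoid_morphism (@pi1_map x).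
Proof. by split; [exact: pi1_map1|exact: pi1_mapM]. Qed.

HB.instance Definition _ (x : X) :=
  isUMagmaMorphism.Build (pi1 R x) (pi1 R (f x)) (@pi1_map x)
    (pi1_map_morphism x).

End induced_morphism.
Arguments pi1_map R {X Y} f x a.

Section local_conditions.
Variables (R : realType) (T : topologicalType).
Local Notation I := (unit_interval R).

Definition path_connected (A : set T) : Prop :=
  forall x y, A x -> A y ->
    exists p : {path I from x to y in T}, range p `<=` A.

Definition locally_path_connected : Prop :=
  forall (x : T) (U : set T), nbhs x U ->
    exists V : set T, [/\ open V, V x, V `<=` U & path_connected V].

(* Every point x has a neighborhood U whose inclusion into T induces the
   trivial map on fundamental groups based at x. *)
Definition semilocally_simply_connected : Prop :=
  forall x : T, exists2 U : set T, nbhs x U &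
    forall p : {path I from x to x in T}, range p `<=` U ->
      path_homotopic p (const_path x).

End local_conditions.

Definition homeomorphism_between {E Y : topologicalType}
    (A : set E) (B : set Y) (p : E -> Y) : Prop :=
  {within A, continuous p} /\
  exists g : Y -> E, [/\ {within B, continuous g}, set_fun A B p, set_fun B A g,
    {in A, cancel p g} & {in B, cancel g p}].

Definition evenly_covered {E Y : topologicalType} (p : E -> Y) (U : set Y) : Prop :=
  exists S : set (set E), [/\ forall V, S V -> open V, trivIset S id,
    p @^-1` U = \bigcup_(V in S) V &
    forall V, S V -> homeomorphism_between V U p].

(* Not required to be surjective: the total space may be empty. *)
Definition is_covering {E Y : topologicalType} (p : E -> Y) : Prop :=
  continuous p /\
  forall y, exists U : set Y, [/\ open U, U y & evenly_covered p U].

Record covering (Y : topologicalType) := Covering {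
  cov_total :> topologicalType;
  cov_proj : cov_total -> Y;
  cov_is_covering : is_covering cov_proj }.

Section coverings.
Context {Y : topologicalType}.
Implicit Types E F : covering Y.

Definition is_cov_morphism E F (t : E -> F) : Prop :=
  continuous t /\ forall e, cov_proj e = cov_proj (t e).

Definition cov_isomorphic E F : Prop :=
  exists (t : E -> F) (u : F -> E),
    [/\ is_cov_morphism t, is_cov_morphism u, cancel t u & cancel u t].

Definition finite_sheeted E : Prop :=
  forall y : Y, finite_set (@cov_proj Y E @^-1` [set y]).

End coverings.

Definition finitely_many_components (T : topologicalType) : Prop :=
  finite_set (range (connected_component [set: T])).

Section pullback.
Context {X Y : topologicalType} (f : continuousType X Y) (E : covering Y).

Definition pullback_set : set (X * E) := [set xe | f xe.1 = cov_proj xe.2].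

Definition pullback_total : topologicalType := set_type pullback_set.

Definition pullback_proj (z : pullback_total) : X := (\val z).1.

Lemma pullback_is_covering : is_covering pullback_proj.
Proof.
have cval : continuous (\val : pullback_total -> X * E).
  exact: initial_continuous.
split=> [z|x].
  by apply: (@continuous_comp _ _ _ (\val : pullback_total -> X * E) fst);
    [exact: cval|exact: cvg_fst].
have [_ /(_ (f x)) [U [oU Ufx [S [oS tS US hS]]]]] := cov_is_covering E.
have ofU : open (f @^-1` U).
  by apply: open_comp => // ? _; exact: cts_fun.
exists (f @^-1` U); split => //.
pose lift (V : set E) : set pullback_total := [set z | V (\val z).2].
have ol V : open V -> open (lift V).
  move=> oV; apply: (@open_comp _ _ (snd \o (\val : pullback_total -> X * E))) => //.
  by move=> z _; apply: continuous_comp; [exact: cval|exact: cvg_snd].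
have pE (z : pullback_total) : f (\val z).1 = cov_proj (\val z).2.
  by have /set_mem := valP z.
exists [set lift V | V in S]; split.
- by move=> _ [V SV <-]; exact/ol/oS.
- move=> _ _ [V SV <-] [W SW <-] [z [/= zV zW]].
  by rewrite (tS V W) //; exists (\val z).2.
- apply/seteqP; split=> z /=; rewrite /pullback_proj pE.
    rewrite -[U _]/((@cov_proj Y E @^-1` U) (\val z).2) US => -[V SV Vz].
    by exists (lift V) => //; exists V.
  move=> [_ [V SV <-] Vz].
  by rewrite -[U _]/((@cov_proj Y E @^-1` U) (\val z).2) US; exists V.
- move=> _ [V SV <-]; have [_ [g [cg pVU gUV pgK gpK]]] := hS V SV.
  split.
    apply: continuous_subspaceT => z.
    by apply: (@continuous_comp _ _ _ (\val : pullback_total -> X * E) fst);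
      [exact: cval|exact: cvg_fst].
  have gP x' : U (f x') -> (x', g (f x')) \in pullback_set.
    by move=> Ux'; apply/mem_set; rewrite /pullback_set /= gpK //; exact/mem_set.
  pose z0 : pullback_total := exist (fun xe => xe \in pullback_set) _ (gP x Ufx).
  pose h (x' : X) : pullback_total := insubd z0 (x', g (f x')).
  have hE x' : U (f x') -> \val (h x') = (x', g (f x')).
    by move=> Ux'; rewrite insubdK //; exact: (gP x' Ux').
  exists h; split.
  + apply: continuous_comp_initial.
    apply: (@subspace_eq_continuous _ _ _ (fun x' : X => (x', g (f x')))).
      by move=> x' /set_mem Ux'; apply/esym/hE.
    move: cg; rewrite !continuous_open_subspace // => cg x' /set_mem Ux'.
    have c1 : {for x', continuous (fun u : X => u)} by [].
    have c2 : {for x', continuous (g \o f)}.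
      apply: continuous_comp; first exact: cts_fun.
      by apply: cg; exact/mem_set.
    exact: (cvg_pair c1 c2).
  + by move=> z /= Vz; rewrite /pullback_proj pE; exact: pVU.
  + by move=> x' Ux'; change (V (\val (h x')).2); rewrite (hE x' Ux'); exact: gUV.
  + move=> z /set_mem /= Vz; apply: val_inj.
    have Uz : U (f (pullback_proj z)) by rewrite /pullback_proj pE; exact: pVU.
    rewrite (hE _ Uz) /pullback_proj pE pgK; last exact/mem_set.
    by rewrite -surjective_pairing.
  + by move=> x' /set_mem Ux'; rewrite /pullback_proj (hE x' Ux').
Qed.

Definition cov_pullback : covering X := Covering pullback_is_covering.

End pullback.

Record Gset (G : groupType) := MkGset {
  Gset_sort :> Type;
  Gset_act : Gset_sort -> G -> Gset_sort;
  Gset_act1 : forall s, Gset_act s 1%g = s;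
  Gset_actM : forall s g h, Gset_act s (g * h)%g = Gset_act (Gset_act s g) h }.

Section Gsets.
Context {G : groupType}.
Implicit Types S T : Gset G.

Definition is_equivariant S T (t : S -> T) : Prop :=
  forall s g, t (Gset_act s g) = Gset_act (t s) g.

Definition Gset_isomorphic S T : Prop :=
  exists (t : S -> T) (u : T -> S),
    [/\ is_equivariant t, is_equivariant u, cancel t u & cancel u t].

Definition orbit_of S (s : S) : set S := range (Gset_act s).

Definition orbit_space S : set (set S) := range (@orbit_of S).

Definition finite_index (H : set G) : Prop :=
  finite_set (range (fun g : G => [set (h * g)%g | h in H])).

End Gsets.
Arguments orbit_space {G} S.

Section Gset_pullback.
Context {J G : groupType} (phi : UMagmaMorphism.type J G) (S : Gset G).

Definition pullback_act (s : S) (j : J) : S := Gset_act s (phi j).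

Lemma pullback_act1 s : pullback_act s 1%g = s.
Proof. by rewrite /pullback_act gmulf1 Gset_act1. Qed.

Lemma pullback_actM s j k :
  pullback_act s (j * k)%g = pullback_act (pullback_act s j) k.
Proof. by rewrite /pullback_act gmulfM Gset_actM. Qed.

Definition Gset_pullback : Gset J := MkGset pullback_act1 pullback_actM.

End Gset_pullback.

(* Main.v *)
(* Write J = pi_1(X, x0), G = pi_1(Y, y0), and H for the image of J in G.  Given a
   G-set S, the associated covering is the set Y x S, where coordinates in the
   fiber over y are read along a chosen path from y0 to y; a set is open if with
   each of its points it contains the transports of that point along all paths
   in some neighborhood of its base point.  Path lifting recovers S from this
   covering, and a J-isomorphism between restricted G-sets gives an isomorphism
   of pulled back coverings, so only G-sets remain to be found.

   If H has infinite index, the regular G-set and two copies of it both restrict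
   to [G:H] copies of the regular H-set.

   If H has finite index n > 1, let A = G/H.  As H-sets A = 1 + A' with
   |A'| = n - 1, so the H-set of injective k-tuples satisfies
   A_(k) = A'_(k) + k A'_(k-1), whence the alternating sum of the G-sets
   (n!/k!) A_(k), for k = 0, ..., n, vanishes on H.  The terms with k even and
   those with k odd are the two G-sets; they differ because the only terms with a
   G-fixed point are the n! points of k = 0. *)
Require Import Defs.
From HB Require Import structures.
From mathcomp Require Import all_boot all_order all_algebra.
From mathcomp Require Import all_classical all_reals topology normedtype.
From mathcomp Require Import continuous_path.
From mathcomp Require Import lra.
Set Implicit Arguments.
Unset Strict Implicit.
Unset Printing Implicit Defensive.
Import Order.TTheory GRing.Theory Num.Theory numFieldNormedType.Exports.
Local Open Scope classical_set_scope.
Local Open Scope ring_scope.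
Local Open Scope card_scope.

(** * Paths and transport *)

Section paths.
Context {R : realType} {X : topologicalType}.
Local Notation I := (unit_interval R).

Lemma range_concat {x y z : X} (p : {path I from x to y in X})
    (q : {path I from y to z in X}) (A : set X) :
  range p `<=` A -> range q `<=` A -> range (concat p q) `<=` A.
Proof.
move=> pA qA _ [s _ <-]; rewrite /= /mk_path /concat_fun.
by case: ifP => _; [apply: pA|apply: qA]; exact: imageT.
Qed.

Lemma range_inverse {x y : X} (p : {path I from x to y in X}) :
  range (inverse p) `<=` range p.
Proof. by move=> _ [s _ <-]; exact: imageT. Qed.

Lemma range_end {x y : X} (p : {path I from x to y in X}) (A : set X) :
  range p `<=` A -> A y.
Proof. by move=> pA; apply: pA; exists one => //; exact: path_one. Qed.

(** The points reachable from [x] form an open and closed set: a path-connected neighborhood of any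
    point lies inside it or misses it. *)
Lemma connected_path_connected :
  connected [set: X] -> locally_path_connected R X ->
  forall x y : X, $|{path I from x to y in X}|.
Proof.
move=> cX lX x y.
pose C := [set z | $|{path I from x to z in X}|].
suff CT : C = setT by change (C y); rewrite CT.
have near_C z : exists2 V : set X, open_nbhs z V &
    (C z -> V `<=` C) /\ (V `&` C !=set0 -> C z).
  have [V [oV Vz _ pcV]] := lX z setT filterT.
  exists V => //; split.
    by move=> /unsquash p w /(pcV z w Vz)[q _]; exact/squash/(concat p q).
  move=> [w [/pcV /(_ Vz)[q _] /unsquash p]].
  exact/squash/(concat p q).
apply: cX.
- by exists x; exact/squash/(const_path x).
- exists C; last by rewrite setTI.
  rewrite openE => z Cz; have [V [oV Vz] [/(_ Cz) VC _]] := near_C z.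
  by apply: (filterS VC); exact: open_nbhs_nbhs.
- exists C; last by rewrite setTI.
  move=> z clz; have [V zV [_ VC]] := near_C z.
  by apply: VC; rewrite setIC; apply: clz; exact: open_nbhs_nbhs.
Qed.

Section subpath.
Context {x y : X} (p : {path I from x to y in X}).

Definition subpath_fun (a b : R) (s : I) : X := p (clamp (a + (b - a) * iR s)).

Lemma subpath_continuous a b : continuous (subpath_fun a b).
Proof.
move=> s; apply: (@continuous_comp _ _ _ (fun s : I => a + (b - a) * iR s)
  (p \o clamp)).
  apply: continuousD; first exact: cst_continuous.
  by apply: continuousM; [exact: cst_continuous|exact: continuous_iR].
by apply: continuous_comp; [exact: continuous_clamp|exact: cts_fun].
Qed.

Lemma subpath_zero a b : subpath_fun a b zero = p (clamp a).
Proof. by rewrite /subpath_fun iR0 mulr0 addr0. Qed.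

Lemma subpath_one a b : subpath_fun a b one = p (clamp b).
Proof. by rewrite /subpath_fun iR1 mulr1 addrC subrK. Qed.

Definition subpath (a b : R) :
    {path I from p (clamp a) to p (clamp b) in X} :=
  mk_path (@subpath_continuous a b) (subpath_zero a b) (subpath_one a b).

Lemma concat_subpath a b c :
  path_homotopic (concat (subpath a b) (subpath b c)) (subpath a c).
Proof.
have affine (u v : R) : continuous (fun t : R => u + v * t).
  move=> t; apply: continuousD; first exact: cst_continuous.
  by apply: continuousM; [exact: cst_continuous|move=> ?].
(* Both sides are reparametrizations of [p]; the first goes affinely from [a] to [b], then from [b]
   to [c]. *)
apply: (@path_homotopic_reparam _ _ _ _ _ _ p _ _
  (fun t => if t <= 2^-1 then a + (b - a) * 2 * t else
     (b - (c - b)) + (c - b) * 2 * t) (fun t => a + (c - a) * t)).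
- apply: (@paste_continuous _ _ _ id (fun t => a + (b - a) * 2 * t)
    (fun t => (b - (c - b)) + (c - b) * 2 * t)).
  + by move=> ?.
  + exact: affine.
  + exact: affine.
  + by move=> t ->; lra.
- exact: affine.
- by rewrite !mulr0 ifT //; lra.
- by rewrite ifF; [lra|apply/negbTE; rewrite -ltNge; lra].
- move=> s; rewrite /= /mk_path /concat_fun /= /mk_path /subpath_fun.
  have s0 := iR_ge0 s; have s1 := iR_le1 s.
  case: ifPn => hs; rewrite clampK; try (by congr (p (clamp _)); lra).
    by apply/andP; split; lra.
  by rewrite -ltNge in hs; apply/andP; split; lra.
- by [].
Qed.

Lemma range_subpath (a b c d : R) (A : set X) : c <= a <= d -> c <= b <= d ->
  (forall t, c <= t <= d -> A (p (clamp t))) -> range (subpath a b) `<=` A.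
Proof.
move=> /andP[ca ad] /andP[cb bd] At _ [s _ <-]; apply: At.
have s0 := iR_ge0 s; have s1 := iR_le1 s.
by apply/andP; split; nra.
Qed.

End subpath.
End paths.

Section transport.
Context {R : realType} {Y : topologicalType} {y0 : Y}.
Local Notation I := (unit_interval R).
Variable b : forall y, {path I from y0 to y in Y}.

(* In terms of coordinates along [b], following [p] multiplies by [transport p]. *)
Definition transport {y1 y2 : Y} (p : {path I from y1 to y2 in Y}) : pi1 R y0 :=
  pi1_class (concat (concat (b y1) p) (inverse (b y2))).

Lemma transport_homotopic {y1 y2 : Y} (p q : {path I from y1 to y2 in Y}) :
  path_homotopic p q -> transport p = transport q.
Proof.
move=> pq; apply/pi1_classP/concat_homotopic; last exact: path_homotopic_refl.
by apply: concat_homotopic => //; exact: path_homotopic_refl.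
Qed.

Lemma concat_inverse_concat {x y z w : Y} (p : {path I from x to z in Y})
    (q : {path I from y to z in Y}) (r : {path I from z to w in Y}) :
  path_homotopic (concat (concat p (inverse q)) (concat q r)) (concat p r).
Proof.
apply: path_homotopic_trans (path_homotopic_sym (concatA _ _ _)) _.
apply: concat_homotopic; first exact: path_homotopic_refl.
apply: path_homotopic_trans (concatA _ _ _) _.
apply: path_homotopic_trans (const_concat _).
apply: concat_homotopic; last exact: path_homotopic_refl.
exact: inverse_concat.
Qed.

Lemma transportM {y1 y2 y3 : Y} (p : {path I from y1 to y2 in Y})
    (q : {path I from y2 to y3 in Y}) :
  transport (concat p q) = (transport p * transport q)%g.
Proof.
rewrite [RHS]pi1_mulE; apply/esym/pi1_classP.
apply: path_homotopic_trans.
  apply: concat_homotopic; first exact: path_homotopic_refl.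
  exact: (path_homotopic_sym (concatA _ _ _)).
apply: path_homotopic_trans; first exact: concat_inverse_concat.
apply: path_homotopic_trans (concatA _ _ _) _.
apply: concat_homotopic; last exact: path_homotopic_refl.
exact: (path_homotopic_sym (concatA _ _ _)).
Qed.

Lemma transport1 (y : Y) : transport (const_path y) = 1%g.
Proof.
apply/pi1_classP; apply: path_homotopic_trans (concat_inverse (b y)).
apply: concat_homotopic; last exact: path_homotopic_refl.
exact: concat_const.
Qed.

Lemma transportV {y1 y2 : Y} (p : {path I from y1 to y2 in Y}) :
  transport (inverse p) = (transport p)^-1%g.
Proof.
apply: (@mulgI _ (transport p)); rewrite -transportM mulgV -(transport1 y1).
by apply: transport_homotopic; exact: concat_inverse.
Qed.

(** With [b y0] null-homotopic, loops at the base point act on its fiber by their own class. *)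
Lemma transport_loop (l : {path I from y0 to y0 in Y}) :
  path_homotopic (b y0) (const_path y0) -> transport l = pi1_class l.
Proof.
move=> b0; apply/pi1_classP.
apply: path_homotopic_trans (concat_const l); apply: concat_homotopic.
  apply: path_homotopic_trans (const_concat l); apply: concat_homotopic => //.
  exact: path_homotopic_refl.
apply: path_homotopic_trans (inverse_homotopic b0) _.
by apply: path_homotopic_eq => s.
Qed.

(** Amounts to paths in [U] with common ends being homotopic in [Y]; [U] itself may fail to be
    simply connected. *)
Definition transport_unique (U : set Y) : Prop :=
  forall (y1 y2 : Y) (p q : {path I from y1 to y2 in Y}),
    range p `<=` U -> range q `<=` U -> transport p = transport q.

Lemma simple_nbhd :
  locally_path_connected R Y -> semilocally_simply_connected R Y ->
  forall (y : Y) (W : set Y), nbhs y W -> exists U : set Y,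
    [/\ open U, U y, U `<=` W, path_connected R U & transport_unique U].
Proof.
move=> lY sY y W Wy; have [N Ny N1] := sY y.
have [U [oU Uy UWN pcU]] := lY y (W `&` N) (filterI Wy Ny).
exists U; split => //; first by move=> z /UWN[].
move=> y1 y2 p q pU qU.
have Uy1 : U y1 by apply: pU; exists zero => //; exact: path_zero.
have [a aU] := pcU _ _ Uy Uy1.
have UN (z1 z2 : Y) (r : {path I from z1 to z2 in Y}) : range r `<=` U -> range r `<=` N.
  by move=> rU; apply: (subset_trans rU) => z /UWN[].
(* Semilocal simple connectedness speaks of loops based at [y], so the loop formed by [p] and [q] is
   conjugated by a path [a] from [y]. *)
have /N1/transport_homotopic : range
    (concat (concat (concat a p) (inverse q)) (inverse a)) `<=` N.
  apply: UN; apply: range_concat; last exact: (subset_trans (@range_inverse _ _ _ _ _)).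
  apply: range_concat; last exact: (subset_trans (@range_inverse _ _ _ _ _)).
  exact: range_concat.
rewrite !transportM !transportV transport1 => /(congr1 (fun u => u * transport a)%g).
rewrite mulgVK mul1g => /(congr1 (fun u => u * transport q)%g); rewrite mulgVK.
exact: mulgI.
Qed.

End transport.

Lemma Gset_act_inj (G : groupType) (S : Gset G) (g : G) :
  injective (fun s : S => Gset_act s g).
Proof.
move=> s t /(congr1 (fun u => Gset_act u g^-1%g)).
by rewrite -!Gset_actM mulgV !Gset_act1.
Qed.

(** * The covering associated with a G-set *)

Section associated_bundle.
Context {R : realType} {Y : topologicalType} {y0 : Y}.
Local Notation I := (unit_interval R).

(* The point [(y, s)] stands for the class of [(b y, s)]; [b] matters only for the
   topology. *)
Definition bundle (b : forall y, {path I from y0 to y in Y})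
  (S : Gset (pi1 R y0)) : Type := (Y * S)%type.

Variables (b : forall y, {path I from y0 to y in Y}) (S : Gset (pi1 R y0)).
Local Notation E := (bundle b S).

HB.instance Definition _ := gen_eqMixin E.
HB.instance Definition _ := gen_choiceMixin E.

Definition bundle_open : set_system E := [set W | forall (y : Y) (s : S),
  W (y, s) -> exists U : set Y, [/\ open U, U y &
    forall (y' : Y) (p : {path I from y to y' in Y}), range p `<=` U ->
      W (y', Gset_act s (transport b p))]].

Lemma bundle_openT : bundle_open setT.
Proof. by move=> y s _; exists setT; split => //; exact: openT. Qed.

Lemma bundle_openI : setI_closed bundle_open.
Proof.
move=> V W oV oW y s [/oV[U [oU Uy UV]] /oW[U' [oU' Uy' UW]]].
exists (U `&` U'); split => //; first exact: openI.
by move=> y' p pU; split; [apply: UV|apply: UW] => z /pU[].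
Qed.

Lemma bundle_open_bigU (J : Type) (F : J -> set E) :
  (forall i, bundle_open (F i)) -> bundle_open (\bigcup_i F i).
Proof.
move=> oF y s [i _ /oF[U [oU Uy UF]]].
by exists U; split => // y' p /UF; exists i.
Qed.

HB.instance Definition _ := isOpenTopological.Build E
  bundle_openT bundle_openI bundle_open_bigU.

Lemma openE_bundle : open = bundle_open.
Proof. by []. Qed.

Definition bundle_proj (z : E) : Y := z.1.

Lemma bundle_proj_continuous : continuous bundle_proj.
Proof.
apply/continuousP => A oA; rewrite openE_bundle => y s As; exists A; split => // y' p pA.
exact: (range_end pA).
Qed.

(** For path-connected [U] with unique transport, this is the slice over [U] through [(y, s)]. *)
Definition sheet (U : set Y) (y : Y) (s : S) : set E :=
  [set z | exists2 p : {path I from y to z.1 in Y},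
     range p `<=` U & z.2 = Gset_act s (transport b p)].

Lemma sheet_self (U : set Y) y s : U y -> sheet U y s (y, s).
Proof.
move=> Uy; exists (const_path y); first by move=> _ [? _ <-].
by rewrite transport1 Gset_act1.
Qed.

Lemma open_sheet (U : set Y) y s : open U -> open (sheet U y s).
Proof.
move=> oU; rewrite openE_bundle => y1 s1 [/= p pU ->]; exists U.
split => //; first exact: range_end pU.
move=> y2 q qU; exists (concat p q); first exact: range_concat.
by rewrite transportM Gset_actM.
Qed.

Lemma nbhs_bundle y s (W : set E) : nbhs ((y, s) : E) W ->
  exists U : set Y, [/\ open U, U y &
    forall (y' : Y) (p : {path I from y to y' in Y}), range p `<=` U ->
      W (y', Gset_act s (transport b p))].
Proof.
rewrite nbhsE => -[V [+ Vys] VW].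
rewrite openE_bundle => oV; have [U [oU Uy UV]] := oV y s Vys.
by exists U; split => // y' p /UV/VW.
Qed.

Hypotheses (lY : locally_path_connected R Y)
  (sY : semilocally_simply_connected R Y).

(** Paths in [U] provide a section, and uniqueness of transport makes it inverse to the
    projection. *)
Lemma sheet_homeomorphism (U : set Y) y s : open U -> U y ->
  path_connected R U -> transport_unique b U ->
  homeomorphism_between (sheet U y s) U bundle_proj.
Proof.
move=> oU Uy pcU uU; split.
  by apply: continuous_subspaceT; exact: bundle_proj_continuous.
have /choice[g gE] : forall y' : Y, exists z : E, U y' ->
    z.1 = y' /\ sheet U y s z.
  move=> y'; have [Uy'|] := pselect (U y'); last by exists (y, s).
  have [p pU] := pcU _ _ Uy Uy'.
  by exists (y', Gset_act s (transport b p)) => _; split => //; exists p.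
exists g; split.
- rewrite continuous_open_subspace // => y1 /set_mem Uy1 W.
  have [] := gE _ Uy1; case: (g y1) => _ s1 /= -> [/= p pU ->].
  move=> /nbhs_bundle[U' [oU' Uy1' U'W]].
  (* [V] lies in [U], where the section is defined, and in [U'], along whose paths transports stay
     in [W]. *)
  have [V [oV Vy1 VU pcV uV]] := simple_nbhd b lY sY
    (filterI (open_nbhs_nbhs (conj oU Uy1)) (open_nbhs_nbhs (conj oU' Uy1'))).
  apply: (@filterS _ _ _ V); last exact: open_nbhs_nbhs.
  move=> y2 Vy2 /=; have [q qV] := pcV _ _ Vy1 Vy2.
  have /gE[] : U y2 by have [] := VU _ Vy2.
  case: (g y2) => _ s2 /= -> [/= r rU ->].
  (* The section at [y2] comes from some path [r] in [U]; uniqueness replaces it by [p] followed by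
     the short path [q]. *)
  rewrite (uU _ _ r (concat p q)) //.
    rewrite transportM Gset_actM; apply: U'W.
    by apply: (subset_trans qV) => z /VU[].
  by apply: range_concat => //; apply: (subset_trans qV) => z /VU[].
- by move=> z [p pU _]; exact: range_end pU.
- by move=> y' /gE[].
- move=> z /set_mem [p pU zE]; have [] := gE _ (range_end pU).
  rewrite /bundle_proj; case: z p pU zE => y1 s1 /= p pU ->.
  case: (g y1) => _ s2 /= -> [/= q qU ->].
  by rewrite (uU _ _ p q).
- by move=> y' /set_mem /gE[].
Qed.

Lemma bundle_is_covering : is_covering bundle_proj.
Proof.
split; first exact: bundle_proj_continuous.
move=> y; have [U [oU Uy _ pcU uU]] := simple_nbhd b lY sY (@filterT _ (nbhs y) _).
exists U; split => //; exists (range (sheet U y)); split.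
- by move=> _ [s _ <-]; exact: open_sheet.
- move=> _ _ [s _ <-] [s' _ <-] [[y1 s1] [[/= p pU ->] [/= q qU]]].
  by rewrite (uU _ _ p q) // => /Gset_act_inj ->.
- apply/seteqP; split => [[y1 s1] /= Uy1|].
    have [p pU] := pcU _ _ Uy Uy1.
    (* The sheet through [(y1, s1)] is indexed by the transport of [s1] back to [y]. *)
    exists (sheet U y (Gset_act s1 (transport b p)^-1%g)).
      by exists (Gset_act s1 (transport b p)^-1%g).
    by exists p => //; rewrite -Gset_actM mulVg Gset_act1.
  by move=> z [_ [s _ <-] [p pU _]]; exact: range_end pU.
- by move=> _ [s _ <-]; exact: sheet_homeomorphism.
Qed.

Definition assoc_covering : covering Y := Covering bundle_is_covering.

Lemma assoc_covering_finite_sheeted :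
  finite_set [set: S] -> finite_sheeted assoc_covering.
Proof.
move=> fS y; apply: (@sub_finite_set _ _ ((fun s => (y, s) : E) @` setT)).
  by move=> [y1 s] /= <-; exists s.
exact: finite_image.
Qed.

End associated_bundle.

(** * Unique path lifting and recovery of a G-set from its covering *)

Section path_lifting.
Context {R : realType} {Y : topologicalType} {y0 : Y}.
Local Notation I := (unit_interval R).
Variable b : forall y, {path I from y0 to y in Y}.

Lemma unit_interval_connected : connected [set: I].
Proof.
have -> : [set: I] = clamp @` `[0%R : R, 1%R].
  apply/seteqP; split => // s _; exists (iR s); last exact: iRK.
  by rewrite /= in_itv /= iR_ge0 iR_le1.
apply: connected_continuous_connected; first exact: segment_connected.
by apply: continuous_subspaceT; exact: continuous_clamp.
Qed.

Lemma near_subpath {y1 y2 : Y} (p : {path I from y1 to y2 in Y}) (r0 : I)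
    (U : set Y) : nbhs (p r0) U ->
  \forall r \near r0, range (subpath p (iR r0) (iR r)) `<=` U.
Proof.
move=> Up.
have : nbhs (iR r0) ((p \o clamp) @^-1` U).
  have cp : {for iR r0, continuous (p \o clamp)}.
    by apply: continuous_comp; [exact: continuous_clamp|exact: cts_fun].
  by apply: cp; rewrite /= iRK.
move=> /nbhs_ballP[e /= e0 eU].
have : \forall r \near r0, ball (iR r0) e (iR r).
  by apply: continuous_iR; exact: nbhsx_ballx.
apply: filterS => r /= rr0.
apply: (@range_subpath _ _ _ _ p _ _ (Num.min (iR r0) (iR r)) (Num.max (iR r0) (iR r))).
- by rewrite ge_min lexx /= le_max lexx.
- by rewrite ge_min lexx orbT /= le_max lexx orbT.
- move=> t /andP[]; rewrite ge_min le_max => h1 h2; apply: eU.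
  move: rr0; rewrite /ball /= !ltr_norml => /andP[h3 h4].
  by apply/andP; split; case/orP: h1 => h1; case/orP: h2 => h2; lra.
Qed.

(** Endpoints such as [p (clamp 0)] and [y1] are equal but not convertible, so the two paths have
    different types. *)
Lemma eq_transport {y1 y2 z1 z2 : Y} (p : {path I from y1 to y2 in Y})
    (q : {path I from z1 to z2 in Y}) :
  y1 = z1 -> y2 = z2 -> p =1 q -> transport b p = transport b q.
Proof.
move=> e1 e2; subst z1 z2 => pq.
exact/transport_homotopic/path_homotopic_eq.
Qed.

Lemma transport_subpath_full {y1 y2 : Y} (p : {path I from y1 to y2 in Y}) :
  transport b (subpath p 0 1) = transport b p.
Proof.
apply: eq_transport; rewrite ?clamp0 ?clamp1 ?path_zero ?path_one //.
by move=> s; rewrite /= /mk_path /subpath_fun subr0 mul1r add0r iRK.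
Qed.

Lemma transport_subpathM {y1 y2 : Y} (p : {path I from y1 to y2 in Y})
    (r s t : R) :
  transport b (subpath p r t) =
  (transport b (subpath p r s) * transport b (subpath p s t))%g.
Proof. by rewrite -transportM; exact/esym/transport_homotopic/concat_subpath. Qed.

(** Splitting at [r] shows that this element equals its own square. *)
Lemma transport_subpath_cst {y1 y2 : Y} (p : {path I from y1 to y2 in Y})
  (r : R) : transport b (subpath p r r) = 1%g.
Proof.
by apply: (@mulgI _ (transport b (subpath p r r))); rewrite -transport_subpathM mulg1.
Qed.

Lemma eq_transport_unique (U : set Y) {y1 y2 z1 z2 : Y}
    (p : {path I from y1 to y2 in Y}) (q : {path I from z1 to z2 in Y}) :
  transport_unique b U -> y1 = z1 -> y2 = z2 -> range p `<=` U ->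
  range q `<=` U -> transport b p = transport b q.
Proof. by move=> uU e1 e2; subst z1 z2; exact: uU. Qed.

Section lift.
Variable S : Gset (pi1 R y0).
Local Notation E := (bundle b S).

(** The base point is written [p (clamp (iR r))] rather than [p r] to match the end of the
    subpath. *)
Definition lift {y1 y2 : Y} (p : {path I from y1 to y2 in Y}) (s : S) (r : I) : E :=
  (p (clamp (iR r)), Gset_act s (transport b (subpath p 0 (iR r)))).

(** The lift at [r] is the lift at [r0] transported along the subpath between them, which stays near
    [p r0]. *)
Lemma lift_continuous {y1 y2 : Y} (p : {path I from y1 to y2 in Y}) (s : S) :
  continuous (lift p s).
Proof.
move=> r0 W /nbhs_bundle[U [oU Ur0 UW]].
have : nbhs (p r0) U by apply: open_nbhs_nbhs; split => //; rewrite iRK in Ur0.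
move=> /near_subpath; apply: filterS => r /UW.
by rewrite -Gset_actM -transport_subpathM.
Qed.

Lemma lift_zero {y1 y2 : Y} (p : {path I from y1 to y2 in Y}) (s : S) :
  lift p s zero = (y1, s).
Proof. by rewrite /lift iR0 transport_subpath_cst Gset_act1 clamp0 path_zero. Qed.

Lemma lift_one {y1 y2 : Y} (p : {path I from y1 to y2 in Y}) (s : S) :
  lift p s one = (y2, Gset_act s (transport b p)).
Proof. by rewrite /lift iR1 transport_subpath_full clamp1 path_one. Qed.

Lemma bundle_component {y1 y2 : Y} (p : {path I from y1 to y2 in Y}) (s : S) :
  connected_component [set: E] (y1, s) =
  connected_component [set: E] (y2, Gset_act s (transport b p)).
Proof.
apply: same_connected_component.
apply: (@connected_component_max _ _ (range (lift p s))) => //.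
- by exists zero => //; exact: lift_zero.
- apply: connected_continuous_connected; first exact: unit_interval_connected.
  by apply: continuous_subspaceT; exact: lift_continuous.
- by exists one => //; exact: lift_one.
Qed.

Hypotheses (lY : locally_path_connected R Y)
  (sY : semilocally_simply_connected R Y).

(** Agreement of [h] with the lift is locally constant on the connected interval: near [r0], [h]
    stays in one sheet, so [h r] is [h r0] transported along the subpath. *)
Lemma lift_unique {y1 y2 : Y} (p : {path I from y1 to y2 in Y}) (h : I -> E) :
  continuous h -> (forall r, (h r).1 = p r) ->
  forall r, (h r).2 = Gset_act (h zero).2 (transport b (subpath p 0 (iR r))).
Proof.
move=> ch hp.
pose C := [set r | (h r).2 = Gset_act (h zero).2 (transport b (subpath p 0 (iR r)))].
suff CT : C = setT by move=> r; change (C r); rewrite CT.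
have step r0 : \forall r \near r0, C r <-> C r0.
  have [U [oU Ur0 _ pcU uU]] := simple_nbhd b lY sY (@filterT _ (nbhs (h r0).1) _).
  have hs : \forall r \near r0, sheet U (h r0).1 (h r0).2 (h r).
    apply: ch; apply: open_nbhs_nbhs; split; first exact: open_sheet.
    by move: (sheet_self b (h r0).2 Ur0); rewrite -surjective_pairing.
  have : nbhs (p r0) U by apply: open_nbhs_nbhs; split => //; rewrite -hp.
  move=> /near_subpath hU; near=> r.
  have pU : range (subpath p (iR r0) (iR r)) `<=` U by near: r.
  have [q qU hr] : sheet U (h r0).1 (h r0).2 (h r) by near: r.
  have {}hr : (h r).2 = Gset_act (h r0).2 (transport b (subpath p (iR r0) (iR r))).
    rewrite hr; congr (Gset_act _ _); apply: (eq_transport_unique uU) => //.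
    - by rewrite hp iRK.
    - by rewrite hp iRK.
  rewrite /C /= hr (transport_subpathM p 0 (iR r0) (iR r)) Gset_actM.
  split; last by move=> ->.
  exact: Gset_act_inj.
apply: unit_interval_connected.
- by exists zero; rewrite /C /= iR0 transport_subpath_cst Gset_act1.
- exists C; last by rewrite setTI.
  rewrite openE => r0 Cr0; apply: filterS (step r0) => r Cr; exact/Cr.
- exists C; last by rewrite setTI.
  move=> r0 clr; have [r [Cr Crr]] := clr _ (step r0).
  exact/Crr.
Unshelve. all: by end_near. Qed.

End lift.

Section monodromy.
Implicit Types S T : Gset (pi1 R y0).
Hypotheses (lY : locally_path_connected R Y)
  (sY : semilocally_simply_connected R Y)
  (b0 : path_homotopic (b y0) (const_path y0)).

Definition fiber_map S T (t : bundle b S -> bundle b T) (s : S) : T := (t (y0, s)).2.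

Lemma fiber_mapE S T (t : assoc_covering b S lY sY -> assoc_covering b T lY sY) s :
  is_cov_morphism t -> t (y0, s) = (y0, fiber_map t s).
Proof.
move=> tm; rewrite [LHS]surjective_pairing; congr (_, _).
exact: (esym (tm.2 (y0, s))).
Qed.

(** [t] carries the lift of [l] to a path over [l], whose end is known by uniqueness of lifts. *)
Lemma fiber_map_equivariant S T
    (t : assoc_covering b S lY sY -> assoc_covering b T lY sY) :
  is_cov_morphism t -> is_equivariant (fiber_map t).
Proof.
move=> [ct tp] s; apply: pi1_ind => l.
have ch : continuous (t \o lift l s).
  move=> r; apply: continuous_comp; last exact: ct.
  exact: lift_continuous.
have := lift_unique lY sY (p := l) ch _ one.
rewrite iR1 transport_subpath_full /= lift_one lift_zero transport_loop //.
by apply => r; rewrite -[LHS]tp /= /lift iRK.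
Qed.

Lemma assoc_covering_isomorphic S T :
  cov_isomorphic (assoc_covering b S lY sY) (assoc_covering b T lY sY) ->
  Gset_isomorphic S T.
Proof.
move=> [t [u [tm um tK uK]]]; exists (fiber_map t), (fiber_map u).
split; [exact: fiber_map_equivariant|exact: fiber_map_equivariant| |] => s.
- by rewrite {1}/fiber_map -fiber_mapE // tK.
- by rewrite {1}/fiber_map -fiber_mapE // uK.
Qed.

End monodromy.
End path_lifting.

(** * Components of the associated covering *)

Section components.
Context {R : realType} {Y : topologicalType} {y0 : Y}.
Local Notation I := (unit_interval R).
Variables (b : forall y, {path I from y0 to y in Y}) (S : Gset (pi1 R y0)).
Hypotheses (lY : locally_path_connected R Y)
  (sY : semilocally_simply_connected R Y)
  (b0 : path_homotopic (b y0) (const_path y0)).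

(** Every point shares its component with a point over [y0], and points over [y0] in one orbit share
    theirs. *)
Lemma assoc_covering_components :
  finite_set (orbit_space S) ->
  finitely_many_components (assoc_covering b S lY sY).
Proof.
move=> fS.
pose comp (s : S) := connected_component [set: bundle b S] (y0, s).
(* The union over an orbit yields its common component without choosing a representative. *)
apply: (@sub_finite_set _ _
  ((fun O : set S => \bigcup_(s in O) comp s) @` orbit_space S)).
  move=> _ [[y s] _ <-].
  pose s' := Gset_act s (transport b (b y))^-1%g.
  exists (orbit_of s'); first exact: imageT.
  have -> : connected_component [set: bundle b S] (y, s) = comp s'.
    rewrite /comp (bundle_component b (b y)) /s' -Gset_actM.
    by rewrite mulVg Gset_act1.
  apply/seteqP; split => [z [_ [g _ <-]]|z s'z]; last first.
    by exists s' => //; exists 1%g => //; exact: Gset_act1.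
  elim/(@pi1_ind R) : g => l.
  by rewrite /comp -(transport_loop l b0) -bundle_component.
exact: finite_image.
Qed.

End components.

(** * Pullbacks *)

Section pullback_bundle.
Context {R : realType} {X Y : topologicalType}.
Local Notation I := (unit_interval R).
Variables (f : continuousType X Y) (x0 : X).
Local Notation y0 := (f x0).
Variable b : forall y, {path I from y0 to y in Y}.
Hypotheses (lX : locally_path_connected R X) (lY : locally_path_connected R Y)
  (sY : semilocally_simply_connected R Y)
  (b0 : path_homotopic (b y0) (const_path y0)).
Variable a : forall x, {path I from x0 to x in X}.
Implicit Types S T : Gset (pi1 R y0).

Definition push {x x' : X} (p : {path I from x to x' in X}) :
  {path I from f x to f x' in Y} := f \o p.

Lemma push_concat {x x' x'' : X} (p : {path I from x to x' in X})
    (q : {path I from x' to x'' in X}) :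
  transport b (push (concat p q)) = (transport b (push p) * transport b (push q))%g.
Proof.
rewrite -transportM; apply/transport_homotopic/path_homotopic_eq => s.
by rewrite /= /mk_path /concat_fun /=; case: ifP.
Qed.

Lemma push_inverse {x x' : X} (p : {path I from x to x' in X}) :
  transport b (push (inverse p)) = (transport b (push p))^-1%g.
Proof. by rewrite -transportV; exact/transport_homotopic/path_homotopic_eq. Qed.

Definition base_transport (x : X) : pi1 R y0 := transport b (push (a x)).

(** The witness is the class of the loop at [x0] made of [a x], [p] and the reverse of [a x']. Read
    at [x0], transport along images of paths in [X] is thus the action of J. *)
Lemma transport_push {x x' : X} (p : {path I from x to x' in X}) :
  exists j : pi1 R x0, (base_transport x * transport b (push p) =
    pi1_map R f x0 j * base_transport x')%g.
Proof.
exists (pi1_class (concat (concat (a x) p) (inverse (a x')))).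
rewrite pi1_mapE -(transport_loop _ b0) -/(push _) !push_concat push_inverse.
by rewrite mulgVK.
Qed.

(* [t] commutes only with J, so it is applied in the fiber over [x0], to which
   the fiber over [f x] is identified along the image of a path in X. *)
Definition twist S T (t : S -> T) (x : X) (s : S) : T :=
  Gset_act (t (Gset_act s (base_transport x)^-1%g)) (base_transport x).

Lemma twist_transport S T
    (t : Gset_pullback (pi1_map R f x0) S -> Gset_pullback (pi1_map R f x0) T)
    (x x' : X) (p : {path I from x to x' in X}) s : is_equivariant t ->
  twist t x' (Gset_act s (transport b (push p))) =
  Gset_act (twist t x s) (transport b (push p)).
Proof.
move=> et; have [j jE] := transport_push p.
have jE' : transport b (push p) = ((base_transport x)^-1 *
    (pi1_map R f x0 j * base_transport x'))%g by rewrite -jE mulKg.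
rewrite /twist jE' -!Gset_actM !mulgA mulgK mulgV mul1g !Gset_actM.
by congr (Gset_act _ _); exact: et.
Qed.

Section pullback_map.
Variables (S T : Gset (pi1 R y0))
  (t : Gset_pullback (pi1_map R f x0) S -> Gset_pullback (pi1_map R f x0) T).
Local Notation ES := (assoc_covering b S lY sY).
Local Notation ET := (assoc_covering b T lY sY).

Definition pullback_fun (z : pullback_total f ES) : X * ET :=
  ((\val z).1, ((\val z).2.1, twist t (\val z).1 (\val z).2.2)).

Lemma pullback_fun_subproof z : pullback_fun z \in @pullback_set _ _ f ET.
Proof. by apply/mem_set; have /set_mem := valP z. Qed.

Definition pullback_map (z : cov_pullback f ES) : cov_pullback f ET :=
  exist (fun u => u \in @pullback_set _ _ f ET) _ (pullback_fun_subproof z).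

(** Only continuity of the fiber coordinate is at stake; it holds because [twist] commutes with
    transport along images of paths in [X]. *)
Lemma pullback_map_morphism : is_equivariant t -> is_cov_morphism pullback_map.
Proof.
move=> et; split => //.
have cval : continuous (\val : pullback_total f ES -> X * ES).
  exact: initial_continuous.
have c1 : continuous (fun z : pullback_total f ES => (\val z).1).
  by move=> z; apply: (@continuous_comp _ _ _ (\val : pullback_total f ES -> X * ES) fst);
    [exact: cval|exact: cvg_fst].
have c2 : continuous (fun z : pullback_total f ES => (\val z).2).
  by move=> z; apply: (@continuous_comp _ _ _ (\val : pullback_total f ES -> X * ES) snd);
    [exact: cval|exact: cvg_snd].
have valE (z : pullback_total f ES) :
    (\val z).2 = (f (\val z).1, (\val z).2.2) :> ES.
  have fz : f (\val z).1 = (\val z).2.1 by have /set_mem := valP z.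
  by rewrite fz; exact: surjective_pairing.
apply: continuous_comp_initial; apply: pair_continuous => // z W.
set x := (\val z).1; set s := (\val z).2.2.
have -> : (\val z).2.1 = f x by rewrite valE.
move=> /nbhs_bundle[U [oU Ux UW]].
have [U' [oU' Ux' U'U pcU' uU']] :=
  simple_nbhd b lY sY (open_nbhs_nbhs (conj oU Ux)).
have fU' : nbhs x (f @^-1` U').
  have cf : {for x, continuous f} by exact: cts_fun.
  by apply: cf; exact: (open_nbhs_nbhs (conj oU' Ux')).
(* Local path-connectedness of [X] supplies paths in [X] whose images stay in [U']. *)
have [N [oN Nx NU' pcN]] := lX fU'.
have zN : \forall z' \near z, N (\val z').1.
  by apply: c1; exact: (open_nbhs_nbhs (conj oN Nx)).
have zV : \forall z' \near z, sheet U' (f x) s (\val z').2.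
  apply: c2; apply: open_nbhs_nbhs; split; first exact: open_sheet.
  by rewrite valE; exact: sheet_self.
apply: filterS2 zN zV => z' Nx'.
rewrite /= valE => -[/= p pU' ->].
have [q qN] := pcN _ _ Nx Nx'.
have qU' : range (push q) `<=` U'.
  by move=> _ [r _ <-]; apply: NU'; apply: qN; exact: imageT.
(* The path [p] in [Y] need not come from [X]; uniqueness in [U'] exchanges it for the image of
   [q]. *)
rewrite (uU' _ _ p (push q)) // twist_transport //; apply: UW.
exact: subset_trans U'U.
Qed.

End pullback_map.

Lemma pullback_mapK S T
  (t : Gset_pullback (pi1_map R f x0) S -> Gset_pullback (pi1_map R f x0) T)
  (u : Gset_pullback (pi1_map R f x0) T -> Gset_pullback (pi1_map R f x0) S) :
  cancel t u -> cancel (pullback_map t) (pullback_map u).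
Proof.
move=> tK z; apply: val_inj; rewrite /= /pullback_fun /= /twist.
rewrite -!Gset_actM mulgV Gset_act1 tK -Gset_actM mulVg Gset_act1.
by rewrite -!surjective_pairing.
Qed.

Lemma pullback_assoc_covering S T :
  Gset_isomorphic (Gset_pullback (pi1_map R f x0) S)
                  (Gset_pullback (pi1_map R f x0) T) ->
  cov_isomorphic (cov_pullback f (assoc_covering b S lY sY))
                 (cov_pullback f (assoc_covering b T lY sY)).
Proof.
move=> [t [u [et eu tK uK]]]; exists (pullback_map t), (pullback_map u).
by split; [exact: pullback_map_morphism|exact: pullback_map_morphism|
  exact: pullback_mapK|exact: pullback_mapK].
Qed.

End pullback_bundle.

(** * Subgroups of infinite index *)

Lemma infinite_set_nat_inj (T : Type) (D : set T) : infinite_set D ->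
  exists2 k : nat -> T, injective k & forall n, D (k n).
Proof.
move=> /infiniteP/card_leP[k].
exists (fun n => \val (k (SigSub (mem_set (I : [set: nat] n))))).
  move=> m n /val_inj /(@inj _ _ _ k); rewrite !in_setT => /(_ isT isT).
  by move=> /(congr1 \val).
by move=> n; exact: set_valP.
Qed.

(** Hilbert's hotel: a sequence in [D] is shifted by the number of points outside [D], which move
    into the freed places. *)
Lemma absorb_finite (T : choiceType) (D : set T) :
  infinite_set [set: T] -> finite_set (~` D) ->
  exists2 h : T -> T, injective h & forall x, D (h x).
Proof.
move=> iT fD; have iD : infinite_set D.
  by move=> fD'; apply: iT; rewrite -(setUv D) finite_setU.
have [k' k'I k'D] := infinite_set_nat_inj iD.
have /finite_seqP[s sE] := fD.
(* [i] reads off the position in the sequence; its default 0 elsewhere is harmless, as [h] tests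
   [k' (i x) == x]. *)
have [i iK] : exists i : T -> nat, forall n, i (k' n) = n.
  pose i x := if pselect (exists n, k' n = x) is left e then projT1 (cid e) else 0%N.
  exists i => n; rewrite /i; case: pselect => [e|[]]; last by exists n.
  by case: cid => m /= /k'I.
pose h x := if x \in s then k' (index x s)
  else if k' (i x) == x then k' (i x + size s)%N else x.
have sP x : (x \in s) <-> ~ D x by have := congr1 (@^~ x) sE; rewrite /= => ->.
exists h; last first.
  move=> x; rewrite /h; case: ifPn => // xs; case: ifPn => // _.
  by have [//|/sP] := pselect (D x); rewrite (negbTE xs).
have nk' n : (k' n \in s) = false by apply/negP => /sP; apply; exact: k'D.
move=> x y; rewrite /h; case: (ifPn (x \in s)) => xs; case: (ifPn (y \in s)) => ys.
- by move=> /k'I; exact: index_inj.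
- case: ifPn => [_ /k'I xy|/eqP ny xy].
    by move: xs; rewrite -index_mem xy ltnNge leq_addl.
  by case: ny; rewrite -xy iK.
- case: ifPn => [_ /k'I xy|/eqP nx xy].
    by move: ys; rewrite -index_mem -xy ltnNge leq_addl.
  by case: nx; rewrite xy iK.
- case: (ifPn (_ == x)) => [/eqP ex|/eqP nx];
    case: (ifPn (_ == y)) => [/eqP ey|/eqP ny] //.
  + by move=> /k'I /addIn exy; rewrite -ex exy.
  + by move=> xy; case: ny; rewrite -xy iK.
  + by move=> xy; case: nx; rewrite xy iK.
Qed.

(** * Doubling an infinite set *)

Section doubling.
Variable T : choiceType.

(* Graphs of bijections from [bool * D] onto [D], for [D] a subset of [T]. *)
Definition doubling_graph (C : set ((bool * T) * T)) : Prop :=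
  [/\ forall u y z, C (u, y) -> C (u, z) -> y = z,
      forall u v y, C (u, y) -> C (v, y) -> u = v &
      forall c x, (exists y, C ((c, x), y)) <-> (exists u, C (u, x))].

(** Zorn's lemma applies since any two pairs in the union of a chain lie in one member. *)
Lemma maximal_doubling_graph :
  exists C, doubling_graph C /\ forall C', C `<` C' -> ~ doubling_graph C'.
Proof.
apply: Zorn_bigcup => F FP Ftot.
have join C C' : F C -> F C' -> exists2 C'', F C'' & C `<=` C'' /\ C' `<=` C''.
  move=> FC FC'; have [CC'|C'C] := Ftot _ _ FC FC'.
    by exists C'; [|split].
  by exists C; [|split].
split.
- move=> u y z [C FC Cy] [C' FC' Cz]; have [C'' FC'' [s1 s2]] := join _ _ FC FC'.
  have [fC _ _] := FP _ FC''; exact: fC (s1 _ Cy) (s2 _ Cz).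
- move=> u v y [C FC Cu] [C' FC' Cv]; have [C'' FC'' [s1 s2]] := join _ _ FC FC'.
  have [_ fC _] := FP _ FC''; exact: fC (s1 _ Cu) (s2 _ Cv).
- move=> c x; split=> -[y [C FC Cy]]; have [_ _ CE] := FP _ FC.
    have /CE[u Cu] : exists y, C ((c, x), y) by exists y.
    by exists u, C.
  have /(CE c)[u Cu] : exists u, C (u, x) by exists y.
  by exists u, C.
Qed.

(** For a maximal graph, [D] has finite complement, since otherwise a sequence outside [D] could be
    adjoined. Hence [T] injects into [D], [bool * T] injects into [T], and Cantor-Bernstein
    concludes. *)
Lemma infinite_double : infinite_set [set: T] ->
  exists f : bool * T -> T, bijective f.
Proof.
move=> iT; have [C [[C1 C2 CE] Cmax]] := maximal_doubling_graph.
pose D := [set x | exists u, C (u, x)].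
have fD : finite_set (~` D).
  apply: contrapT => /infinite_set_nat_inj[k' k'I k'D].
  (* The bijection (c, n) |-> 2n + c from bool x nat to nat, carried along [k']. *)
  pose C' := [set w : (bool * T) * T |
    exists n, w.1.2 = k' n /\ w.2 = k' (n.*2 + w.1.1)%N].
  have CD c x y : C ((c, x), y) -> D x by move=> Cxy; apply/(CE c); exists y.
  apply: (Cmax (C `|` C')).
    split; first by left.
    move=> C'C; have w : C' ((false, k' 0%N), k' 0%N) by exists 0%N.
    by have /CD/(k'D 0%N) := C'C _ (or_intror w).
  split.
  - move=> [c x] y z [Cy|[m [/= xm ym]]] [Cz|[n [/= xn zn]]].
    + exact: C1 Cy Cz.
    + by case: (k'D n); rewrite -xn; exact: CD Cy.
    + by case: (k'D m); rewrite -xm; exact: CD Cz.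
    + by rewrite ym zn; move: xm; rewrite xn => /k'I ->.
  - move=> [c x] [d y] z [Cx|[m [/= xm zm]]] [Cy|[n [/= yn zn]]].
    + exact: C2 Cx Cy.
    + by case: (k'D (n.*2 + d)%N); rewrite -zn; exists (c, x).
    + by case: (k'D (m.*2 + c)%N); rewrite -zm; exists (d, y).
    + move: zm; rewrite zn => /k'I nm.
      have cd : c = d.
        by move/(congr1 odd): nm; rewrite !oddD !odd_double !oddb !addFb => ->.
      by move: nm; rewrite xm yn cd => /addIn/double_inj ->.
  - move=> c x; split => [[y [Cy|[n [/= xn _]]]]|[u [Cu|[n [/= un xn]]]]].
    + by have [u Cu] := CD _ _ _ Cy; exists u; left.
    + exists (odd n, k' n./2); right; exists n./2; split => //=.
      by rewrite addnC odd_double_half.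
    + have /(CE c)[y Cy] : D x by exists u.
      by exists y; left.
    + exists (k' ((n.*2 + u.1).*2 + c)%N); right.
      by exists (n.*2 + u.1)%N.
have [h hI hD] := absorb_finite iT fD.
have /choice[F FE] : forall u : bool * T, exists y, C ((u.1, h u.2), y).
  by move=> u; apply/CE; exact: hD.
have FI : injective F.
  move=> [c x] [d y] Fxy; have := FE (c, x); rewrite Fxy => Cx.
  by have [-> /hI ->] := C2 _ _ _ Cx (FE (d, y)).
have le1 : [set: bool * T] #<= [set: T].
  have [f] : $|{injfun [set: bool * T] >-> [set: T]}|.
    by apply/injfunPex; exists F => // u v _ _; exact: FI.
  exact: inj_card_le f.
have le2 : [set: T] #<= [set: bool * T].
  have [f] : $|{injfun [set: T] >-> [set: bool * T]}|.
    by apply/injfunPex; exists (pair true) => // u v _ _ [].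
  exact: inj_card_le f.
have [x0 _] := infinite_setN0 iT.
pose T' : pointedType := HB.pack T (isPointed.Build T x0).
have /(@card_set_bijP _ T')[f] := Cantor_Bernstein le1 le2.
by rewrite setTT_bijective; exists f.
Qed.
End doubling.

(** * The regular G-set and two copies of it *)

Section regular_Gsets.
Variable G : groupType.

Definition regular_Gset : Gset G :=
  @MkGset G G (fun s g => (s * g)%g) (@mulg1 G) (@mulgA G).

Definition double_regular_act (s : bool * G) (g : G) : bool * G := (s.1, s.2 * g)%g.

Lemma double_regular_act1 s : double_regular_act s 1%g = s.
Proof. by case: s => c s; rewrite /double_regular_act mulg1. Qed.

Lemma double_regular_actM s g h : double_regular_act s (g * h)%g =
  double_regular_act (double_regular_act s g) h.
Proof. by rewrite /double_regular_act mulgA. Qed.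

Definition double_regular_Gset : Gset G :=
  MkGset double_regular_act1 double_regular_actM.

Lemma regular_finite_orbits : finite_set (orbit_space regular_Gset).
Proof.
apply: (@sub_finite_set _ _ [set setT]); last exact: finite_set1.
move=> _ [s _ <-] /=; apply/seteqP; split => // t _.
by exists (s^-1 * t)%g => //=; rewrite mulVKg.
Qed.

Lemma double_regular_finite_orbits :
  finite_set (orbit_space double_regular_Gset).
Proof.
apply: (@sub_finite_set _ _
  ((fun c : bool => [set s : bool * G | s.1 = c]) @` setT)).
  move=> _ [[c s] _ <-]; exists c => //; apply/seteqP; split => [[d t] /= ->|].
    by exists (s^-1 * t)%g => //=; rewrite /double_regular_act /= mulVKg.
  by move=> _ [g _ <-].
exact: finite_image.
Qed.

(** The regular G-set is a single orbit, so its image stays in one of the two copies. *)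
Lemma regular_double_nonisomorphic :
  ~ Gset_isomorphic regular_Gset double_regular_Gset.
Proof.
move=> [t [u [et _ _ uK]]].
have tE g : (t g).1 = (t 1%g).1.
  by have := et 1%g g; rewrite /= mul1g => ->.
by have := tE (u (~~ (t 1%g).1, 1%g)); rewrite uK /=; case: (t 1%g).1.
Qed.

Variables (J : groupType) (phi : UMagmaMorphism.type J G).

(** The J-orbits on [G] are left cosets of the image; the representative depends only on the coset
    as a set. *)
Lemma coset_representative : exists rep : G -> G,
  (forall g j, rep (g * phi j)%g = rep g) /\
  (forall g, exists j, g = (rep g * phi j)%g).
Proof.
pose coset (g : G) := range (fun j => (g * phi j)%g).
have cosetM g j : coset (g * phi j)%g = coset g.
  apply/seteqP; split => _ [k _ <-].
    by exists (j * k)%g => //; rewrite gmulfM mulgA.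
  by exists (j^-1 * k)%g => //; rewrite gmulfM gmulfV -mulgA mulVKg.
have /choice[e eP] : forall O : set G, exists g, O !=set0 -> O g.
  move=> O; have [[g Og]|nO] := pselect (O !=set0); first by exists g.
  by exists 1%g.
exists (e \o coset); split => [g j|g] /=; first by rewrite cosetM.
have [|j _ <-] := eP (coset g).
  by exists g, 1%g => //; rewrite gmulf1 mulg1.
by exists j^-1%g; rewrite gmulfV mulgK.
Qed.

Lemma regular_double_pullback : ~ finite_index (range phi) ->
  Gset_isomorphic (Gset_pullback phi regular_Gset)
                  (Gset_pullback phi double_regular_Gset).
Proof.
move=> nfin; have [rep [repM repE]] := coset_representative.
have rep_id g : rep (rep g) = rep g.
  by have [j gE] := repE g; rewrite [in RHS]gE repM.
pose T := set_type (range rep).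
pose cls (g : G) : T := SigSub (mem_set (imageT rep g)).
have clsM g j : cls (g * phi j)%g = cls g by apply: val_inj; exact: repM.
have cls_val (t : T) : cls (\val t) = t.
  apply: val_inj; have [g _ <-] := set_valP t; exact: rep_id.
have rep_val (t : T) : rep (\val t) = \val t.
  by have [g _ <-] := set_valP t; exact: rep_id.
have iT : infinite_set [set: T].
  move=> fT; apply: nfin.
  (* [finite_index] counts right cosets while [T] indexes left ones; inversion exchanges them. *)
  apply: sub_finite_set (finite_image
    (fun t : T => [set (h * (\val t)^-1)%g | h in range phi]) fT).
  move=> _ [g _ <-]; exists (cls g^-1%g) => //=.
  have [j gE] := repE g^-1%g.
  have {gE} : g = (phi j^-1 * (rep g^-1)^-1)%g by rewrite gmulfV -invgM -gE invgK.
  move: (rep g^-1)%g => r ->; apply/seteqP; split => _ [_ [i _ <-] <-].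
    exists (phi (i * j)%g); first exact: imageT.
    by rewrite mulgA -gmulfM mulgK.
  exists (phi (i * j^-1)%g); first exact: imageT.
  by rewrite gmulfM mulgA.
have [f [f' fK f'K]] := infinite_double iT.
(* Write g = r h with r the representative and h in the image: [t] and [u] move r by the doubling
   bijection and keep h. *)
pose t (g : G) : bool * G :=
  ((f' (cls g)).1, \val (f' (cls g)).2 * ((rep g)^-1 * g))%g.
pose u (s : bool * G) : G := (\val (f (s.1, cls s.2)) * ((rep s.2)^-1 * s.2))%g.
have repV g : exists j, ((rep g)^-1 * g)%g = phi j.
  by have [j gE] := repE g; exists j; rewrite {2}gE mulKg.
exists t, u; split.
- move=> g j; rewrite /= /pullback_act /= /double_regular_act /t /=.
  by rewrite clsM repM !mulgA.
- move=> [c g] j; rewrite /= /pullback_act /= /double_regular_act /u /=.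
  by rewrite clsM repM !mulgA.
- move=> g; rewrite /u /t /=; have [j jE] := repV g.
  rewrite jE clsM cls_val -surjective_pairing f'K /= repM rep_val mulKg -jE.
  by rewrite mulVKg.
- move=> [c g]; rewrite /u /t /=; have [j jE] := repV g.
  rewrite jE clsM cls_val fK /= repM rep_val mulKg -jE.
  by rewrite mulVKg.
Qed.

End regular_Gsets.

(** * Subgroups of finite index *)

(** There are (k+1)(k+2)...n = n!/k! such sequences of length n - k. *)
Fixpoint bounded (k : nat) (v : seq nat) : bool :=
  if v is i :: v' then (i <= k)%N && bounded k.+1 v' else true.

Lemma bounded_nseq0 k m : bounded k (nseq m 0%N).
Proof. by elim: m k => //= m IH k; exact: IH. Qed.

Lemma bounded_le k v : bounded k v -> {in v, forall i, (i <= k + size v)%N}.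
Proof.
elim: v k => // i v IH k /= /andP[ik /IH bv] j; rewrite inE => /orP[/eqP ->|/bv].
  exact: leq_trans (leq_addr _ _).
by rewrite addSnnS.
Qed.

Lemma finite_seqs (T : eqType) (P : set T) (n : nat) : finite_set P ->
  finite_set [set u : seq T | (size u <= n)%N /\ {in u, forall x, P x}].
Proof.
move=> fP; elim: n => [|n IH].
  apply: (@sub_finite_set _ _ [set [::]]); last exact: finite_set1.
  by move=> [|x u] [].
apply: (@sub_finite_set _ _ ([set [::]] `|`
  [set x :: u | x in P & u in [set u | (size u <= n)%N /\ {in u, forall x, P x}]])).
  move=> [|x u] [/= un uP]; [by left|right].
  exists x; first by apply: uP; rewrite mem_head.
  by exists u => //; split => // y yu; apply: uP; rewrite inE yu orbT.
by rewrite finite_setU; split; [exact: finite_set1|exact: finite_image2].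
Qed.

(** * The parity-reversing involution on states *)

Section toggle.
Variables (A : eqType) (p : A) (n : nat).

(* A state is an injective k-tuple with a choice of one of the n!/k! sequences v
   such that v_i <= k + i. *)
Definition state (e : bool) (x : seq A * seq nat) : bool :=
  [&& uniq x.1, (size x.1 + size x.2 == n)%N, bounded (size x.1) x.2 &
      odd (size x.1) == e].

(* This realizes (n!/k!) k A'_(k-1) = (n!/(k-1)!) A'_(k-1): the position of p is
   moved between the tuple and the sequence. *)
Definition toggle (x : seq A * seq nat) : seq A * seq nat :=
  if p \in x.1 then (rem p x.1, index p x.1 :: x.2)
  else (take (head 0%N x.2) x.1 ++ p :: drop (head 0%N x.2) x.1, behead x.2).

(** Bounds the size of [A] by [n]: when [p] is missing from the tuple, the sequence is not empty and
    has a head to consume. *)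
Hypothesis small : forall u : seq A, uniq u -> p \notin u -> (size u < n)%N.

(** In a tuple of size k the index of [p] is at most k - 1, exactly the bound on the head once the
    tuple has size k - 1. *)
Lemma state_toggle e x : state e x -> state (~~ e) (toggle x).
Proof.
case: x => u v /and4P[/= uu /eqP uv bv /eqP <-]; rewrite /toggle /state /=.
case: ifPn => pu /=.
  have : (0 < size u)%N by case: (u) pu.
  have su := size_rem pu; rewrite su; case: (size u) uv bv (index_mem p u) su => // k.
  rewrite /= pu ltnS addSnnS => -> -> -> _ _.
  by rewrite rem_uniq // eqxx /= negbK eqxx.
case: v uv bv => [|i v] /= uv; first by have := small uu pu; rewrite -uv addn0 ltnn.
move=> /andP[iu bv].
rewrite (@perm_uniq _ _ (p :: u)); last first.
  rewrite perm_sym -[in X in perm_eq (_ :: X)](cat_take_drop i u) perm_sym.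
  by rewrite perm_catC /= perm_cons perm_catC.
have sE : size (take i u ++ p :: drop i u) = (size u).+1.
  by rewrite size_cat /= addnS -size_cat cat_take_drop.
by rewrite sE /= pu uu addSnnS uv eqxx bv eqxx.
Qed.

Lemma toggleK e : {in state e, cancel toggle toggle}.
Proof.
move=> [u v]; rewrite -topredE /= => /and4P[/= uu /eqP uv bv _]; rewrite {2}/toggle /=.
case: ifPn => pu; rewrite /toggle /=.
  rewrite mem_rem_uniq // !inE eqxx /=; congr (_, _).
  have iu : size (take (index p u) u) = index p u by rewrite size_takel // index_size.
  rewrite remE take_size_cat // drop_size_cat //.
  by rewrite -[X in X :: _](nth_index p pu) -drop_nth ?index_mem // cat_take_drop.
case: v uv bv => [|i v] /= uv; first by have := small uu pu; rewrite -uv addn0 ltnn.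
move=> /andP[iu _]; rewrite mem_cat inE eqxx orbT.
(* As [p] does not occur before position [i], its index after insertion is again [i]. *)
have put : p \notin take i u by apply: contra pu; exact: mem_take.
have st : size (take i u) = i by rewrite size_takel.
rewrite remE index_cat (negbTE put) /= eqxx addn0 st take_size_cat //.
by rewrite -cat_rcons drop_size_cat ?size_rcons ?st // cat_take_drop.
Qed.

(** An injection fixing [p] preserves its position; for the action of J this gives equivariance. *)
Lemma toggle_map (h : A -> A) x : injective h -> h p = p ->
  toggle (map h x.1, x.2) = (map h (toggle x).1, (toggle x).2).
Proof.
case: x => u v hI hp; rewrite /toggle /= -{1 2 3}hp mem_map //.
case: ifPn => pu /=; last by rewrite map_cat /= map_take map_drop hp.
rewrite index_map //; congr (_, _).
by elim: u {pu} => //= a u ->; rewrite (inj_eq hI) [RHS]fun_if.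
Qed.

End toggle.

(** * Even and odd states as G-sets *)

Section state_Gsets.
Variables (G : groupType) (A : Gset G) (n : nat).
Local Notation cA := {classic A}.

Definition state_type (e : bool) : Type := {x : seq cA * seq nat | state n e x}.

Lemma state_map (h : cA -> cA) e x : injective h ->
  state n e x -> state n e (map h x.1, x.2).
Proof. by move=> hI; rewrite /state /= map_inj_uniq // size_map. Qed.

Definition state_act e (x : state_type e) (g : G) : state_type e :=
  exist (fun x => state n e x) _ (state_map (@Gset_act_inj G A g) (valP x)).

Lemma state_act1 e (x : state_type e) : state_act x 1%g = x.
Proof.
apply: val_inj; case: x => -[u v] ? /=; congr (_, _).
by rewrite -[RHS]map_id; apply: eq_map => a; exact: Gset_act1.
Qed.

Lemma state_actM e (x : state_type e) g h :
  state_act x (g * h)%g = state_act (state_act x g) h.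
Proof.
apply: val_inj; case: x => -[u v] ? /=; congr (_, _).
by rewrite -map_comp; apply: eq_map => a; exact: Gset_actM.
Qed.

Definition state_Gset (e : bool) : Gset G := MkGset (@state_act1 e) (@state_actM e).

Lemma state_Gset_finite e : finite_set [set: A] -> finite_set [set: state_Gset e].
Proof.
move=> fA.
have fV : finite_set [set v : seq nat | (size v <= n)%N /\ {in v, forall i, `I_n.+1 i}].
  by apply: finite_seqs; exact: finite_II.
have fU := @finite_seqs cA setT n fA.
have : finite_set ((fun x : state_Gset e => \val x) @^-1`
   [set x | state n e x]).
  apply: finite_preimage; first by move=> x y _ _; exact: val_inj.
  apply: sub_finite_set (finite_setX fU fV) => -[u v] /and4P[/= _ /eqP uv bv _].
  split; split => //=; rewrite -uv ?leq_addr ?leq_addl //.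
  by move=> i /(bounded_le bv) iuv; rewrite /= ltnS.
move=> fS; apply: sub_finite_set fS => x _; exact: (valP (x : state_type e)).
Qed.

Hypothesis nofix : forall a : A, exists g, Gset_act a g <> a.

(** The empty tuple is even and fixed by [G]; an odd tuple is not empty, so a fixed one would have a
    fixed first entry. *)
Lemma state_Gset_nonisomorphic :
  ~ Gset_isomorphic (state_Gset false) (state_Gset true).
Proof.
move=> [t [_ [et _ _ _]]].
have s0P : state n false ([::] : seq cA, nseq n 0%N).
  by rewrite /state /= size_nseq add0n eqxx bounded_nseq0.
pose s0 : state_Gset false := exist (fun x => state n false x) _ s0P.
have s0g g : Gset_act s0 g = s0 by apply: val_inj.
have tg g : Gset_act (t s0) g = t s0 by rewrite -et s0g.
case: (t s0) tg => -[[|a u] v] /= st tg; first by case/and4P: (st).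
have [g] := nofix a; apply.
by have /(congr1 \val)[] := tg g.
Qed.

Variables (J : groupType) (phi : UMagmaMorphism.type J G) (p : cA).
Hypothesis p_fixed : forall j, Gset_act (p : A) (phi j) = p.
Hypothesis small : forall u : seq cA, uniq u -> p \notin u -> (size u < n)%N.

Lemma state_Gset_pullback :
  Gset_isomorphic (Gset_pullback phi (state_Gset false))
                  (Gset_pullback phi (state_Gset true)).
Proof.
pose t e (x : state_type e) : state_type (~~ e) :=
  exist (fun x => state n (~~ e) x) _ (state_toggle small (valP x)).
have et e x j : t e (state_act x (phi j)) = state_act (t e x) (phi j).
  by apply: val_inj => /=; apply: toggle_map; [exact: Gset_act_inj|exact: p_fixed].
exists (t false), (t true); split.
- exact: (et false).
- exact: (et true).
- by move=> x; apply: val_inj; exact: (toggleK small (valP x)).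
- by move=> x; apply: val_inj; exact: (toggleK small (valP x)).
Qed.

End state_Gsets.

(** * The G-set of cosets of the image *)

Section coset_Gset.
Variables (J G : groupType) (phi : UMagmaMorphism.type J G).
Local Notation H := (range phi).

Definition right_coset (g : G) : set G := [set (h * g)%g | h in H].

Lemma right_cosetM x g :
  [set (y * g)%g | y in right_coset x] = right_coset (x * g)%g.
Proof.
apply/seteqP; split => [_ [_ [h Hh <-] <-]|_ [h Hh <-]].
  by exists h => //; rewrite mulgA.
by exists (h * x)%g; [exists h|rewrite mulgA].
Qed.

Lemma coset_act_subproof (O : set_type (range right_coset)) (g : G) :
  [set (y * g)%g | y in \val O] \in range right_coset.
Proof.
by apply/mem_set; have [x _ <-] := set_valP O; rewrite right_cosetM; exact: imageT.
Qed.

Definition coset_act (O : set_type (range right_coset)) (g : G) :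
  set_type (range right_coset) := SigSub (coset_act_subproof O g).

Lemma coset_act1 O : coset_act O 1%g = O.
Proof.
by apply: val_inj => /=; have [x _ <-] := set_valP O; rewrite right_cosetM mulg1.
Qed.

Lemma coset_actM O g h : coset_act O (g * h)%g = coset_act (coset_act O g) h.
Proof.
by apply: val_inj => /=; have [x _ <-] := set_valP O; rewrite !right_cosetM mulgA.
Qed.

Definition coset_Gset : Gset G := MkGset coset_act1 coset_actM.

Definition base_coset : coset_Gset := SigSub (mem_set (imageT right_coset 1%g)).

Lemma base_coset_fixed j : Gset_act base_coset (phi j) = base_coset.
Proof.
apply: val_inj => /=; rewrite right_cosetM mul1g.
apply/seteqP; split => _ [_ [k _ <-] <-].
  by exists (phi (k * j)%g); [exact: imageT|rewrite gmulfM mulg1].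
exists (phi (k * j^-1)%g); first exact: imageT.
by rewrite gmulfM gmulfV mulgVK mulg1.
Qed.

(** If Hx is fixed by every conjugate x^-1 z x, then Hzx = Hx, so every z lies in H. *)
Lemma coset_Gset_no_fixed_point : ~ set_surj setT setT phi ->
  forall O : coset_Gset, exists g, Gset_act O g <> O.
Proof.
move=> nsurj O; apply: contrapT => /forallNP fixO; apply: nsurj => z _.
have [x _ xO] := set_valP O.
have /contrapT/(congr1 \val) := fixO (x^-1 * z * x)%g.
rewrite /= -xO right_cosetM => xzE.
have : right_coset (x * (x^-1 * z * x))%g (z * x)%g.
  by exists 1%g; [exists 1%g => //; exact: gmulf1|rewrite mul1g -mulgA mulVKg].
by rewrite xzE => -[h [j _ <-] /mulIg <-]; exists j.
Qed.

Lemma finite_index_Gsets : ~ set_surj setT setT phi -> finite_index H ->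
  exists S T : Gset G, [/\ finite_set [set: S], finite_set [set: T],
    ~ Gset_isomorphic S T &
    Gset_isomorphic (Gset_pullback phi S) (Gset_pullback phi T)].
Proof.
move=> nsurj fin.
have fA : finite_set [set: coset_Gset].
  have : finite_set ((fun O : coset_Gset => \val O) @^-1` range right_coset).
    by apply: finite_preimage => // O O' _ _; exact: val_inj.
  by move=> fC; apply: sub_finite_set fC => O _; exact: set_valP.
have /finite_seqP[s sE] : finite_set [set: {classic coset_Gset}] by exact: fA.
(* [s] lists all cosets, so [u] with the base coset added has size at most [size s], which serves as
   n. *)
have small (u : seq {classic coset_Gset}) : uniq u ->
    (base_coset : {classic coset_Gset}) \notin u -> (size u < size s)%N.
  move=> uu pu; apply: (@uniq_leq_size _ ((base_coset : {classic coset_Gset}) :: u)).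
    by rewrite /= pu.
  by move=> x _; have : [set: {classic coset_Gset}] x by []; rewrite sE.
exists (state_Gset coset_Gset (size s) false), (state_Gset coset_Gset (size s) true).
split; [exact: state_Gset_finite|exact: state_Gset_finite| |].
- exact/state_Gset_nonisomorphic/coset_Gset_no_fixed_point.
- exact: state_Gset_pullback base_coset_fixed small.
Qed.

End coset_Gset.

(** * Base paths and assembly of both statements *)

Lemma base_paths (R : realType) (Y : topologicalType) (y0 : Y) :
  connected [set: Y] -> locally_path_connected R Y ->
  exists b : forall y, {path unit_interval R from y0 to y in Y},
    path_homotopic (b y0) (const_path y0).
Proof.
move=> hY lY; pose c y := unsquash (connected_path_connected hY lY y0 y).
(* Going back along [c y0] first makes the path chosen at [y0] null-homotopic. *)
exists (fun y => concat (inverse (c y0)) (c y)); exact: inverse_concat.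
Qed.

(** Finite G-sets have finitely many orbits, so only infinite index calls for new G-sets. *)
Lemma finite_orbit_Gsets (J G : groupType) (phi : UMagmaMorphism.type J G) :
  ~ set_surj setT setT phi -> exists S T : Gset G,
    [/\ finite_set (orbit_space S), finite_set (orbit_space T),
      ~ Gset_isomorphic S T &
      Gset_isomorphic (Gset_pullback phi S) (Gset_pullback phi T)].
Proof.
move=> nsurj; have [fin|nfin] := pselect (finite_index (range phi)).
  have [S [T [fS fT nST ST]]] := finite_index_Gsets nsurj fin.
  by exists S, T; split => //; exact: finite_image.
exists (regular_Gset G), (double_regular_Gset G); split.
- exact: regular_finite_orbits.
- exact: double_regular_finite_orbits.
- exact: regular_double_nonisomorphic.
- exact: regular_double_pullback.
Qed.


Theorem corollary5p22 (R : realType) (X Y : topologicalType)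
  (hX : connected [set: X]) (lX : locally_path_connected R X)
  (sX : semilocally_simply_connected R X)
  (hY : connected [set: Y]) (lY : locally_path_connected R Y)
  (sY : semilocally_simply_connected R Y)
  (f : continuousType X Y) (x0 : X)
  (f_nsurj : ~ set_surj setT setT (pi1_map R f x0)) :
  (finite_index (range (pi1_map R f x0)) ->
    (exists E1 E2 : covering Y,
      [/\ finite_sheeted E1, finite_sheeted E2, ~ cov_isomorphic E1 E2 &
        cov_isomorphic (cov_pullback f E1) (cov_pullback f E2)]) /\
    (exists S1 S2 : Gset (pi1 R (f x0)),
      [/\ finite_set [set: S1], finite_set [set: S2],
        ~ Gset_isomorphic S1 S2 &
        Gset_isomorphic (Gset_pullback (pi1_map R f x0) S1)
                        (Gset_pullback (pi1_map R f x0) S2)])) /\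
  ((exists E1 E2 : covering Y,
      [/\ finitely_many_components E1, finitely_many_components E2,
        ~ cov_isomorphic E1 E2 &
        cov_isomorphic (cov_pullback f E1) (cov_pullback f E2)]) /\
    (exists S1 S2 : Gset (pi1 R (f x0)),
      [/\ finite_set (orbit_space S1), finite_set (orbit_space S2),
        ~ Gset_isomorphic S1 S2 &
        Gset_isomorphic (Gset_pullback (pi1_map R f x0) S1)
                        (Gset_pullback (pi1_map R f x0) S2)])).
Proof.
have [b b0] := base_paths (f x0) hY lY.
have [a _] := base_paths x0 hX lX.
pose E S := assoc_covering b S lY sY.
(* Nonisomorphism is read off the fibers over the base point; the isomorphism of pullbacks comes
   from [twist]. *)
have EP S T : ~ Gset_isomorphic S T ->
    Gset_isomorphic (Gset_pullback (pi1_map R f x0) S)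
                    (Gset_pullback (pi1_map R f x0) T) ->
    ~ cov_isomorphic (E S) (E T) /\
    cov_isomorphic (cov_pullback f (E S)) (cov_pullback f (E T)).
  move=> nST ST; split; first by move=> /(assoc_covering_isomorphic b0).
  exact: pullback_assoc_covering.
split => [fin|].
  have [S [T [fS fT nST ST]]] := finite_index_Gsets f_nsurj fin.
  have [nE pE] := EP _ _ nST ST; split; last by exists S, T.
  by exists (E S), (E T); split => //; exact: assoc_covering_finite_sheeted.
have [S [T [fS fT nST ST]]] := finite_orbit_Gsets f_nsurj.
have [nE pE] := EP _ _ nST ST; split; last by exists S, T.
by exists (E S), (E T); split => //; exact: assoc_covering_components.
Qed.
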